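(* Let $d \ge 1$ be an integer, $s>0$ and $L>0$. There are constants $c_1 > 0$ depending only on $(d,L)$ and $c_2 > 0$ depending only on $(s,d,L)$ such that the following holds for every integer $m \ge 1$ and every $a \ge 1$. Let $\kappa = \lfloor m^{2/(4s+d)} \rfloor$ (ordinary integer part), $\tau = m + a m \kappa^{-d/2}$, and let $\phi_{\kappa,\tau} = \mathbb{I}\{\Gamma^{\rm one}_\kappa > \tau\}$, where $\Gamma^{\rm one}_\kappa = \sum_{k \in [\kappa]^d} (M_{k,\kappa} - m\kappa^{-d})^2$ is the one-sample chi-squared statistic. Then $$R_\varepsilon^{(m)}(\phi_{\kappa,\tau}; \mathcal{H}_s^d(L)) \le c_1/a^2, \quad \text{if } \varepsilon \ge c_2\, a\, m^{-2s/(4s+d)}.$$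
   Context: Hölder class: for $s>0$, in the definition of the class (only), $\lfloor s \rfloor$ denotes the largest integer strictly smaller than $s$. $\mathcal{H}_s^d(L)$ is the class of functions $f:[0,1]^d \to \mathbb{R}$ having a derivative $f^{(\lfloor s\rfloor)}$ of order $\lfloor s \rfloor$ with $|f^{(\lfloor s \rfloor)}(x) - f^{(\lfloor s \rfloor)}(y)| \le L\|x-y\|^{s-\lfloor s\rfloor}$ for all $x,y\in[0,1]^d$, and such that $\|f^{(s')}\|_\infty \le L$ for all $s' \in \{0,\dots,\lfloor s\rfloor\}$. Here $f^{(k)}$ is the $k$-th order (multilinear) derivative, measured in operator norm, with $f^{(0)} = f$. One-sample problem: $X_1,\dots,X_m$ are i.i.d. with density $f$ with respect to Lebesgue measure $\nu$ on $[0,1]^d$. $[\kappa] = \{1,\dots,\kappa\}$, and for $k \in [\kappa]^d$ the bin count is $M_{k,\kappa} = \#\{i \in \{1,\dots,m\} : X_i \in ((k-1)/\kappa, k/\kappa]\}$, where $((k-1)/\kappa,k/\kappa] = \prod_{j=1}^d ((k_j-1)/\kappa, k_j/\kappa]$. A test $\phi$ is a Borel measurable function of the data with values in $[0,1]$, giving the probability of rejecting the null hypothesis. $\mathbb{E}_f^{(m)}$ denotes expectation when the sample has density $f$. Let $f_0 \equiv 1$ on $[0,1]^d$ and $\delta(f,g) = \|f-g\|_2 = (\int (f-g)^2\,d\nu)^{1/2}$. The worst-case risk of $\phi$ over a class $\mathcal{H}$ is $$R_\varepsilon^{(m)}(\phi;\mathcal{H}) = \mathbb{E}^{(m)}_{f_0}[\phi]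 + \sup\{\mathbb{E}^{(m)}_f[1-\phi] : f \in \mathcal{H},\ \delta(f,f_0) \ge \varepsilon\},$$ where the supremum is over those $f$ that are probability densities, with the supremum over the empty set equal to $0$. *)

(* Defs.v *)
From HB Require Import structures.
From mathcomp Require Import all_boot all_order all_algebra.
From mathcomp Require Import all_classical all_reals all_analysis.
From mathcomp Require Import measurable_realfun.
Import Order.TTheory GRing.Theory Num.Theory numFieldNormedType.Exports.

Set Implicit Arguments.
Unset Strict Implicit.
Unset Printing Implicit Defensive.

Local Open Scope classical_set_scope.
Local Open Scope ring_scope.

(* n-fold product measure, as a plain set function so that it can be applied
   to a [mu] not (yet) known to be a measure. For sigma-finite [mu] it is a
   sigma-finite measure whose values on boxes are given by
   [tuple_measure_box]. *)
Section tuple_measure.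
Context (disp : measure_display) (T : measurableType disp) (R : realType).
Variable mu : set T -> \bar R.

Fixpoint tuple_measure (n : nat) : set (n.-tuple T) -> \bar R :=
  match n with
  | 0 => dirac [tuple]
  | k.+1 => pushforward (product_measure1 mu (tuple_measure (n := k)))
              (fun p => cons_tuple p.1 p.2)
  end.
End tuple_measure.
Arguments tuple_measure {disp T R} mu n _.

Section tuple_measure_theory.
Local Open Scope ereal_scope.
Context (disp : measure_display) (T : measurableType disp) (R : realType).
Variable mu : {sigma_finite_measure set T -> \bar R}.

Let is_sfm n (nu : set (n.-tuple T) -> \bar R) :=
  [/\ nu set0 = 0, forall A, 0 <= nu A, semi_sigma_additive nu
    & sigma_finite setT nu].

Let sfm_ex n (nu : set (n.-tuple T) -> \bar R) : is_sfm nu ->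
  exists nu' : {sigma_finite_measure set (n.-tuple T) -> \bar R},
    nu = nu' :> (_ -> _).
Proof.
move=> [nu0 nu_ge0 nuD nu_fin].
pose m := isMeasure.Build _ _ _ nu nu0 nu_ge0 nuD.
pose m1 : {measure set (n.-tuple T) -> \bar R} := HB.pack nu m.
pose m2 := Measure_isSigmaFinite.Build _ _ _ m1 nu_fin.
pose m3 : {sigma_finite_measure set (n.-tuple T) -> \bar R} := HB.pack nu m1 m2.
by exists m3.
Qed.

Let is_sfm_tuple n : is_sfm (tuple_measure mu n).
Proof.
elim: n => [|n /sfm_ex[nu nuE]].
  by split=> //=; [exact: measure_semi_sigma_additive|exact: sigma_finiteT].
have mc : measurable_fun [set: T * n.-tuple T] (fun p => cons_tuple p.1 p.2).
  exact: measurable_cons measurable_fst measurable_snd.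
rewrite /is_sfm /= nuE /pushforward; split.
- by rewrite preimage_set0 measure0.
- by move=> A; exact: measure_ge0.
- move=> F mF tF mUF; rewrite preimage_bigcup.
  apply: measure_semi_sigma_additive.
  + by move=> k; rewrite -[X in measurable X]setTI; exact: mc.
  + apply/trivIsetP => /= i j _ _ ij; rewrite -preimage_setI.
    by move/trivIsetP : tF => /(_ _ _ _ _ ij) ->//; rewrite preimage_set0.
  + by rewrite -preimage_bigcup -[X in measurable X]setTI; exact: mc.
- have /sigma_finiteP[F [TF ndF Foo]] := sigma_finiteT mu.
  have /sigma_finiteP[G [TG ndG Goo]] := sigma_finiteT nu.
  exists (fun k => [set t : n.+1.-tuple T |
      (F k `*` G k) (thead t, [tuple of behead t])]).
    rewrite predeqE => t; split => // _.
    have [i _ Fi] : (\bigcup_k F k) (thead t) by rewrite -TF.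
    have [j _ Gj] : (\bigcup_k G k) [tuple of behead t] by rewrite -TG.
    exists (maxn i j) => //; split => /=.
      exact: (elimT (subsetPset _ _) (ndF _ _ (leq_maxl i j))) Fi.
    exact: (elimT (subsetPset _ _) (ndG _ _ (leq_maxr i j))) Gj.
  move=> k; have [[mF Fk] [mG Gk]] := (Foo k, Goo k); split.
    rewrite -[X in measurable X]setTI; apply: (measurable_fun_pair _ _) => //.
    - exact: measurable_tnth.
    - exact: measurable_behead.
    - exact: measurableX.
  rewrite [X in (_ \x _) X](_ : _ = F k `*` G k); last first.
    apply/seteqP; split=> -[x t]; rewrite /preimage /=;
      have -> : [tuple of behead (cons_tuple x t)] = t :> n.-tuple T
        by exact: val_inj.
      by [].
    by [].
  by rewrite product_measure1E // lte_mul_pinfty // ge0_fin_numE.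
Qed.

Let tuple_measure0 n : tuple_measure mu n set0 = 0.
Proof. by have [] := is_sfm_tuple n. Qed.
Let tuple_measure_ge0 n A : 0 <= tuple_measure mu n A.
Proof. by have [] := is_sfm_tuple n. Qed.
Let tuple_measure_sigma_additive n : semi_sigma_additive (tuple_measure mu n).
Proof. by have [] := is_sfm_tuple n. Qed.

HB.instance Definition _ n := isMeasure.Build _ _ _ (tuple_measure mu n)
  (@tuple_measure0 n) (@tuple_measure_ge0 n) (@tuple_measure_sigma_additive n).

Let tuple_measure_sigma_finite n : sigma_finite setT (tuple_measure mu n).
Proof. by have [] := is_sfm_tuple n. Qed.

HB.instance Definition _ n := Measure_isSigmaFinite.Build _ _ _
  (tuple_measure mu n) (@tuple_measure_sigma_finite n).

Lemma tuple_measure_box n (A : 'I_n -> set T) :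
  (forall i, measurable (A i)) ->
  tuple_measure mu n [set t | forall i, A i (tnth t i)] =
  \prod_(i < n) mu (A i).
Proof.
elim: n A => [|n IHn] A mA.
  rewrite big_ord0 /= diracE mem_set //= => i; by case: i.
rewrite big_ord_recl -IHn; last by move=> i; exact: mA.
rewrite [LHS]/= -product_measure1E //; last first.
  rewrite [X in measurable X](_ : _ = \bigcap_(i in [set: 'I_n])
    (fun t => tnth t i) @^-1` A (lift ord0 i)).
    apply: fin_bigcap_measurable => // i _.
    by rewrite -[X in measurable X]setTI; exact: measurable_tnth.
  by apply/seteqP; split=> t /= h i; [move=> _|]; exact: h.
rewrite /pushforward; congr (_ _); apply/seteqP; split=> -[x t] /=.
  move=> h; split; first exact: (h ord0).
  by move=> i; have := h (lift ord0 i); rewrite tnthS /=; congr (A _ (tnth _ _)); exact/val_inj.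
move=> [h0 h] i; case: (unliftP ord0 i) => [j ->|->] //.
rewrite tnthS; move: (h j); congr (A _ (tnth _ _)); exact/val_inj.
Qed.
End tuple_measure_theory.

Definition measure_rV_display : measure_display. Proof. exact. Qed.

(* The sigma-algebra generated by the coordinates, that is, the Borel
   sigma-algebra of R^d; same construction as for tuples. *)
Section measurable_rV.
Context (R : realType) (d : nat).

Let coord (i : 'I_d) (x : 'rV[R]_d) : R := x ord0 i.

Let rV_set0 : g_sigma_preimage coord set0.
Proof. exact: sigma_algebra0. Qed.

Let rV_setC A : g_sigma_preimage coord A -> g_sigma_preimage coord (~` A).
Proof. exact: sigma_algebraC. Qed.

Let rV_bigcup (F : nat -> set 'rV[R]_d) :
  (forall i, g_sigma_preimage coord (F i)) ->
  g_sigma_preimage coord (\bigcup_i (F i)).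
Proof. exact: sigma_algebra_bigcup. Qed.

HB.instance Definition _ := @isMeasurable.Build measure_rV_display
  'rV[R]_d (g_sigma_preimage coord) rV_set0 rV_setC rV_bigcup.

End measurable_rV.

Section chi2_testing.
Context (R : realType) (d : nat).
Implicit Types (x y : 'rV[R]_d) (f g : 'rV[R]_d -> R).

Definition lebesgue_rV : set 'rV[R]_d -> \bar R :=
  pushforward (tuple_measure (@lebesgue_measure R) d)
    (fun t : d.-tuple R => \row_i tnth t i).

Lemma measurable_coord (i : 'I_d) :
  measurable_fun [set: 'rV[R]_d] (fun x => x ord0 i).
Proof.
move=> _ A mA; rewrite setTI; apply: sub_sigma_algebra => /=.
rewrite -bigcup_seq /=; exists i => /=; first by rewrite mem_index_enum.
by exists A => //; rewrite setTI.
Qed.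

Let measurable_row :
  measurable_fun [set: d.-tuple R] (fun t => \row_i tnth t i : 'rV[R]_d).
Proof.
move=> _ A mA; rewrite setTI.
have := @g_sigma_preimage_comp _ R d _ (fun i (x : 'rV[R]_d) => x ord0 i) _
  (fun t : d.-tuple R => \row_i tnth t i).
rewrite (_ : (fun i => _ \o _) = (fun i t => tnth t i)); last first.
  by apply/funext => i; apply/funext => t /=; rewrite mxE.
move=> E; rewrite /measurable /= E; exists A => //; exact: setTI.
Qed.

Let lebesgue_rV0 : lebesgue_rV set0 = 0%E.
Proof. by rewrite /lebesgue_rV /pushforward preimage_set0 measure0. Qed.

Let lebesgue_rV_ge0 A : (0 <= lebesgue_rV A)%E.
Proof. exact: measure_ge0. Qed.

Let lebesgue_rV_sigma_additive : semi_sigma_additive lebesgue_rV.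
Proof.
move=> F mF tF mUF; rewrite /lebesgue_rV /pushforward preimage_bigcup.
apply: measure_semi_sigma_additive.
- by move=> k; rewrite -[X in measurable X]setTI; exact: measurable_row.
- apply/trivIsetP => /= i j _ _ ij; rewrite -preimage_setI.
  by move/trivIsetP : tF => /(_ _ _ _ _ ij) ->//; rewrite preimage_set0.
- by rewrite -preimage_bigcup -[X in measurable X]setTI; exact: measurable_row.
Qed.

HB.instance Definition _ := isMeasure.Build _ _ _ lebesgue_rV
  lebesgue_rV0 lebesgue_rV_ge0 lebesgue_rV_sigma_additive.

Lemma lebesgue_rV_box (A : 'I_d -> set R) : (forall i, measurable (A i)) ->
  lebesgue_rV [set x | forall i, A i (x ord0 i)] =
  (\prod_(i < d) lebesgue_measure (A i))%E.
Proof.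
move=> mA; rewrite -tuple_measure_box // /lebesgue_rV /pushforward.
congr tuple_measure; apply/seteqP.
by split=> t /= tA i; move: (tA i); rewrite mxE.
Qed.

Definition unit_cube : set 'rV[R]_d :=
  [set x | forall i, x ord0 i \in `[0, 1]].

Lemma measurable_unit_cube : measurable unit_cube.
Proof.
rewrite [X in measurable X](_ : _ = \bigcap_(i in [set: 'I_d])
  (fun x : 'rV[R]_d => x ord0 i) @^-1` `[0, 1]).
  apply: fin_bigcap_measurable => // i _.
  by rewrite -[X in measurable X]setTI; exact: measurable_coord.
by apply/seteqP; split=> x h i; [move=> _|]; exact: h.
Qed.

Definition enorm x : R := Num.sqrt (\sum_i x ord0 i ^+ 2).

(* k-linear forms on R^d are functions on k-tuples of vectors. *)
Definition kform (k : nat) := k.-tuple 'rV[R]_d -> R.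

Definition multilinear k (T : kform k) : Prop :=
  forall (j : 'I_k) (v : k.-tuple 'rV[R]_d),
    scalar (fun u : 'rV[R]_d => T [tuple if i == j then u else tnth v i | i < k]).

Definition opnorm k (T : kform k) : \bar R :=
  ereal_sup [set `|T v|%:E | v in
    [set v : k.-tuple 'rV[R]_d | forall i, enorm (tnth v i) <= 1]].

(* [D k] is the k-th derivative of [f] for k <= l, in the Frechet sense
   relative to the closed cube (so one-sided at the boundary), for the
   operator norm on k-linear forms. *)
Definition cube_derivatives (l : nat) f (D : forall k, 'rV[R]_d -> kform k) :=
  [/\ forall x, unit_cube x -> D 0%N x [tuple] = f x,
      forall k x, (k <= l)%N -> unit_cube x -> multilinear (D k x)
    & forall k x, (k < l)%N -> unit_cube x ->
      forall e : R, 0 < e -> \forall y \near x, unit_cube y ->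
        (opnorm (fun v => (D k y v - D k x v -
                           D k.+1 x (cons_tuple (y - x) v))%R)
          <= (e * enorm (y - x))%:E)%E].

(* The largest integer strictly smaller than s, for s > 0. *)
Definition strict_floor (s : R) : nat := `|Num.ceil s|%N.-1.

Lemma strict_floorP (s : R) : 0 < s ->
  (strict_floor s)%:R < s <= (strict_floor s).+1%:R.
Proof.
move=> s0; have /gtz0_abs cE : 0 < Num.ceil s by rewrite ceil_gt0.
have c_gt0 : (0 < `|Num.ceil s|)%N by rewrite absz_gt0 gt_eqF // ceil_gt0.
have := ceil_itv s; rewrite -cE -(prednK c_gt0) -/(strict_floor s).
by rewrite -addn1 PoszD addrK !pmulrn.
Qed.

Definition holder (s L : R) : set ('rV[R]_d -> R) :=
  [set f | exists D, let l := strict_floor s in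
    [/\ cube_derivatives l f D,
        forall x y, unit_cube x -> unit_cube y ->
          (opnorm (fun v => (D l x v - D l y v)%R)
            <= (L * enorm (x - y) `^ (s - l%:R))%:E)%E
      & forall k x, (k <= l)%N -> unit_cube x -> (opnorm (D k x) <= L%:E)%E]].

(* Only the values on the cube matter: a function on [0,1]^d is represented by
   any extension to R^d. *)
Definition is_density f : Prop :=
  [/\ measurable_fun unit_cube f,
      forall x, unit_cube x -> 0 <= f x
    & (\int[lebesgue_rV]_(x in unit_cube) (f x)%:E = 1)%E].

Definition L2dist f g : \bar R :=
  ((\int[lebesgue_rV]_(x in unit_cube) ((f x - g x) ^+ 2)%:E) `^ 2^-1)%E.

(* The law of one observation with density [f]; [tuple_measure (law f) m] is
   the law of an i.i.d. sample of size m. *)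
Definition law f : set 'rV[R]_d -> \bar R :=
  fun A => (\int[lebesgue_rV]_(x in unit_cube `&` A) (f x)%:E)%E.

Lemma law_probability f : is_density f ->
  exists P : probability 'rV[R]_d R, law f = P :> (_ -> _).
Proof.
move=> [mf f_ge0 intf1].
have /measurable_EFinP mfE := mf.
have P0 : law f set0 = 0%E by rewrite /law setI0 integral_set0.
have P_ge0 A : (0 <= law f A)%E.
  by apply: integral_ge0 => x [cx _]; rewrite lee_fin f_ge0.
have PD : semi_sigma_additive (law f).
  move=> F mF tF mUF.
  rewrite [X in _ --> X](_ : _ = (\sum_(n <oo) law f (F n))%E).
    by apply/cvg_closeP; split; [exact: is_cvg_nneseries|rewrite closeE].
  rewrite /law setI_bigcupr ge0_integral_bigcup //.
  - by move=> k; apply: measurableI => //; exact: measurable_unit_cube.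
  - apply: measurable_funS mfE; first exact: measurable_unit_cube.
    by move=> x [k _ []].
  - by move=> x [k _ [cx _]]; rewrite lee_fin f_ge0.
  - exact: trivIset_setIl.
pose m := isMeasure.Build _ _ _ (law f) P0 P_ge0 PD.
pose m1 : {measure set 'rV[R]_d -> \bar R} := HB.pack (law f) m.
have PT : m1 setT = 1%E by rewrite /m1 /= /law setIT.
pose m2 := Measure_isProbability.Build _ _ _ m1 PT.
pose P : probability 'rV[R]_d R := HB.pack (law f) m1 m2.
by exists P.
Qed.

Definition uniform_density : 'rV[R]_d -> R := fun=> 1.

Section sample.
Variable m : nat.
Implicit Types (X : m.-tuple 'rV[R]_d) (phi : m.-tuple 'rV[R]_d -> R).

Definition expect f phi : \bar R :=
  (\int[tuple_measure (law f) m]_X (phi X)%:E)%E.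

(* In \bar R the supremum of the empty set is -oo, hence the case split. *)
Definition sup0 (A : set (\bar R)) : \bar R :=
  if A == set0 then 0%E else ereal_sup A.

Definition risk (eps : R) phi (H : set ('rV[R]_d -> R)) : \bar R :=
  (expect uniform_density phi +
   sup0 [set expect f (fun X => (1 - phi X)%R) | f in
          [set f | [/\ H f, is_density f & eps%:E <= L2dist f uniform_density]]])%E.

(* Bins are indexed from 0: coordinate k_j stands for the interval
   (k_j / kappa, (k_j + 1) / kappa]. *)
Definition in_bin (kappa : nat) (k : d.-tuple 'I_kappa) x : bool :=
  [forall j : 'I_d,
     x ord0 j \in `](tnth k j)%:R / kappa%:R, (tnth k j).+1%:R / kappa%:R]].

Definition bin_count (kappa : nat) (k : d.-tuple 'I_kappa) X : nat :=
  #|[pred i : 'I_m | in_bin k (tnth X i)]|.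

Definition chi2_stat (kappa : nat) X : R :=
  \sum_(k : d.-tuple 'I_kappa)
    ((bin_count k X)%:R - m%:R / kappa%:R ^+ d) ^+ 2.

Definition chi2_test (kappa : nat) (tau : R) X : R :=
  (tau < chi2_stat kappa X)%R%:R.

Lemma measurable_chi2_test kappa tau :
  measurable_fun [set: m.-tuple 'rV[R]_d] (chi2_test kappa tau).
Proof.
have mbin (k : d.-tuple 'I_kappa) : measurable [set x | in_bin k x].
  rewrite [X in measurable X](_ : _ = \bigcap_(j in [set: 'I_d])
    (fun x : 'rV[R]_d => x ord0 j) @^-1`
      `](tnth k j)%:R / kappa%:R, (tnth k j).+1%:R / kappa%:R]).
    apply: fin_bigcap_measurable => // j _.
    by rewrite -[X in measurable X]setTI; exact: measurable_coord.
  by apply/seteqP; split=> x /=; [move=> /forallP h j _|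
    move=> h; apply/forallP => j]; exact: h.
have mcount (k : d.-tuple 'I_kappa) :
    measurable_fun setT (fun X => (bin_count k X)%:R : R).
  rewrite (_ : (fun X => _) = (fun X => \sum_(i < m)
      \1_[set x | in_bin k x] (tnth X i))).
    apply: measurable_sum => i; apply: measurableT_comp.
      exact: measurable_indic.
    exact: measurable_tnth.
  apply/funext => X; rewrite /bin_count -sum1_card natr_sum big_mkcond /=.
  apply: eq_bigr => i _; rewrite inE indicE.
  by case: ifPn => h; [rewrite mem_set|rewrite memNset //; exact/negP].
have mstat : measurable_fun setT (@chi2_stat kappa).
  apply: measurable_sum => k; apply: measurable_funX.
  exact: measurable_funB.
apply: (measurableT_comp (f := fun b : bool => b%:R : R)) => //.
exact: measurable_fun_ltr.
Qed.

End sample.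
End chi2_testing.

(* Main.v *)
Require Import Defs.
From HB Require Import structures.
From mathcomp Require Import all_boot all_order all_algebra.
From mathcomp Require Import all_classical all_reals all_analysis.
From mathcomp Require Import measurable_realfun ring lra zify.
Import Order.TTheory GRing.Theory Num.Theory numFieldNormedType.Exports.
Local Open Scope classical_set_scope.
Local Open Scope ring_scope.
Set Implicit Arguments.
Unset Strict Implicit.
Unset Printing Implicit Defensive.

(** Let [K = kappa ^ d] be the number of bins, [p k] the probability of the bin
    [k] and [Delta = \sum_k (p k - 1 / K) ^ 2]. The theorem follows from two
    facts that do not involve each other.

    The test detects [Delta]. The statistic depends on the sample only through
    the bins that contain the observations, so up to a null set its law is a
    law on a finite product space ([expect_cells]). There its mean is about
    [m - m / K + m ^ 2 * Delta], and Hoeffding's decomposition bounds its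
    variance by [8 m ^ 3 (M / K) Delta + 4 m ^ 2 (M / K)] when the density is at
    most [M] ([cell_chi2_variance_le]). Chebyshev's inequality
    ([chi2_test_errors]) then bounds the first error by [4 / a ^ 2], and the
    second one by a multiple of [L / a ^ 2] as soon as [m ^ 2 * Delta] is at
    least [32 a ^ 2 m / sqrt K] ([type_two_margin], [type_two_bound]).

    The bins see the distance. For [f] in the Holder class,
    [\int (f - 1) ^ 2 <= A * K * Delta + C * kappa ^ (- 2 s)]
    ([L2_le_power_gap]). The difficulty is that for [s > 1] replacing [f] by its
    averages over the bins costs [1 / kappa] and not [kappa ^ (- s)]. Instead
    the values of [f] are recovered from several bin averages, with an error of
    order [kappa ^ (- s)]. All that is used of the smoothness is that on a
    segment of length [h] the function [f] is a polynomial of degree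
    [l = strict_floor s] up to [O(h ^ s)] ([holder_segment]), so that Lagrange
    interpolation along segments is exact up to [O(h ^ s)]:
    - if [y] is a vertex of the grid, interpolation at [0] from the nodes
      [n = 1, ..., l + 1] gives [f y = \sum_n w n * f (y + n u / kappa)] up to
      the error. Averaging over [u] in the unit cube turns the terms of the
      right-hand side into averages of [f] over boxes of side [n / kappa] with
      corner [y], which are unions of bins ([holder_vertex]);
    - the value of [f] at any point of the cube is obtained from its values at
      vertices by interpolation in one coordinate after the other
      ([holder_from_vertices]).
    So up to this error [|f - 1|] on a bin is bounded by a multiple of the sum of
    the deviations [K |p k - 1 / K|] over a number of neighbouring bins that does
    not depend on [kappa] ([holder_pointwise]); squaring and integrating gives
    the inequality.

    With [kappa] of the order of [m ^ (2 / (4 s + d))], both [kappa ^ (- 2 s)]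
    and [sqrt K / m] are of the order of [m ^ (- 4 s / (4 s + d))], the square
    of the separation rate. If [kappa] is too small for the interpolation then
    [m] is bounded, and no density of the class is as far from [1] as the
    alternatives require, provided that [c2] is large. *)

(** * Moments of the chi-squared statistic of independent cells *)

Section independent_cells.
Context (R : realFieldType) (B : finType) (p : B -> R) (m : nat).
Hypothesis p_ge0 : forall x, 0 <= p x.
Hypothesis p_sum1 : \sum_x p x = 1.
Implicit Types (c : {ffun 'I_m -> B}) (F G : {ffun 'I_m -> B} -> R).

Definition weight c : R := \prod_i p (c i).

Definition mean F : R := \sum_c weight c * F c.

Definition replace c (i : 'I_m) (w : B) : {ffun 'I_m -> B} :=
  [ffun j => if j == i then w else c j].

Lemma weight_ge0 c : 0 <= weight c.
Proof. exact: prodr_ge0. Qed.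

Lemma weight_sum1 : \sum_c weight c = 1.
Proof.
rewrite /weight -(bigA_distr_bigA (fun (_ : 'I_m) x => p x)) /=.
by rewrite big1.
Qed.

Lemma meanD F G : mean (fun c => F c + G c) = mean F + mean G.
Proof. by rewrite /mean -big_split; apply: eq_bigr => c _; rewrite mulrDr. Qed.

Lemma meanZ a F : mean (fun c => a * F c) = a * mean F.
Proof. by rewrite /mean mulr_sumr; apply: eq_bigr => c _; rewrite mulrCA. Qed.

Lemma mean_sum (I : finType) (P : pred I) (F : I -> {ffun 'I_m -> B} -> R) :
  mean (fun c => \sum_(i | P i) F i c) = \sum_(i | P i) mean (F i).
Proof.
by rewrite /mean exchange_big; apply: eq_bigr => c _; rewrite mulr_sumr.
Qed.

Lemma eq_mean F G : F =1 G -> mean F = mean G.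
Proof. by move=> FG; apply: eq_bigr => c _; rewrite FG. Qed.

Lemma le_mean F G : (forall c, F c <= G c) -> mean F <= mean G.
Proof. by move=> FG; apply: ler_sum => c _; rewrite ler_wpM2l ?weight_ge0. Qed.

Lemma mean_cst a : mean (fun=> a) = a.
Proof. by rewrite /mean -mulr_suml weight_sum1 mul1r. Qed.

(** A coordinate may be exchanged with an independent copy of itself: the map
    which swaps [c i] with [w] is a weight-preserving involution of the pairs
    [(c, w)]. *)
Lemma mean_replace i F :
  mean F = mean (fun c => \sum_w p w * F (replace c i w)).
Proof.
pose swap (u : {ffun 'I_m -> B} * B) := (replace u.1 i u.2, u.1 i).
have swapK : involutive swap.
  move=> [c w]; rewrite /swap /=; congr pair; last by rewrite ffunE eqxx.
  by apply/ffunP => j; rewrite !ffunE; case: eqP => [->|].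
have -> : mean F = \sum_(u : {ffun 'I_m -> B} * B) weight u.1 * p u.2 * F u.1.
  rewrite -(pair_bigA _ (fun c w => weight c * p w * F c)) /=.
  apply: eq_bigr => c _; rewrite -mulr_suml -mulr_sumr p_sum1.
  by rewrite mulr1.
rewrite (reindex_inj (inv_inj swapK)) /=.
rewrite -(pair_bigA _ (fun c w => weight (replace c i w) * p (c i) *
   F (replace c i w))) /=.
apply: eq_bigr => c _; rewrite mulr_sumr; apply: eq_bigr => w _.
rewrite mulrA; congr (_ * _).
rewrite /weight (bigD1 i) //= [in RHS](bigD1 i) //= ffunE eqxx.
rewrite [X in _ * X * _](eq_bigr (fun j => p (c j))); first by ring.
by move=> j /negPf ji; rewrite ffunE ji.
Qed.

Lemma mean_coord i (u : B -> R) : mean (fun c => u (c i)) = \sum_x p x * u x.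
Proof.
rewrite (mean_replace i) -[RHS]mean_cst; apply: eq_mean => c.
by apply: eq_bigr => w _; rewrite ffunE eqxx.
Qed.

Lemma mean_coord2 i j (u : B -> B -> R) : i != j ->
  mean (fun c => u (c i) (c j)) = \sum_x \sum_y p x * p y * u x y.
Proof.
move=> ij; rewrite (mean_replace i).
under eq_mean => c do under eq_bigr => w _ do
  rewrite !ffunE eqxx eq_sym (negPf ij).
rewrite (mean_coord j (fun y => \sum_x p x * u x y)).
rewrite exchange_big /=; apply: eq_bigr => x _; rewrite mulr_sumr.
by apply: eq_bigr => y _; rewrite mulrCA mulrA.
Qed.

Lemma mean_sqr_sum (u : B -> R) : \sum_x p x * u x = 0 ->
  mean (fun c => (\sum_i u (c i)) ^+ 2) = m%:R * \sum_x p x * u x ^+ 2.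
Proof.
move=> u0.
have E c : (\sum_i u (c i)) ^+ 2 = \sum_i \sum_j u (c i) * u (c j).
  by rewrite expr2 mulr_suml; apply: eq_bigr => i _; rewrite mulr_sumr.
have -> : m%:R = \sum_(i < m) 1 :> R by rewrite sumr_const card_ord.
rewrite (eq_mean E) mean_sum mulr_suml.
apply: eq_bigr => i _; rewrite mean_sum mul1r (bigD1 i) //= big1 ?addr0.
  by rewrite (mean_coord i (fun x => u x * u x)).
move=> j ji; rewrite (mean_coord2 (fun x y => u x * u y)) 1?eq_sym //.
under eq_bigr => x _ do under eq_bigr => y _ do rewrite mulrACA.
under eq_bigr => x _ do rewrite -mulr_sumr u0 mulr0.
by rewrite big1.
Qed.

(** A kernel whose sections have mean zero makes the terms of a double sum
    orthogonal, unless they are indexed by the same unordered pair: otherwise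
    some index occurs in one term only and can be integrated out first. *)
Lemma mean_sqr_degenerate_le (g : B -> B -> R) :
  (forall x y, g x y = g y x) -> (forall y, \sum_x p x * g x y = 0) ->
  mean (fun c => (\sum_i \sum_(j | j != i) g (c i) (c j)) ^+ 2) <=
  2 * m%:R ^+ 2 * \sum_x \sum_y p x * p y * g x y ^+ 2.
Proof.
move=> gC g0; set V := \sum_x _.
have V0 : 0 <= V.
  by apply: sumr_ge0 => x _; apply: sumr_ge0 => y _; rewrite mulr_ge0 ?sqr_ge0 // mulr_ge0.
have Efst i j k l : i != j -> i != k -> i != l ->
    mean (fun c => g (c i) (c j) * g (c k) (c l)) = 0.
  move=> ij ik il; rewrite (mean_replace i) -[RHS](mean_cst 0).
  apply: eq_mean => c.
  under eq_bigr => w _ do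
    rewrite !ffunE eqxx !(eq_sym _ i) (negPf ij) (negPf ik) (negPf il) mulrA.
  by rewrite -mulr_suml g0 mul0r.
have E c : (\sum_i \sum_(j | j != i) g (c i) (c j)) ^+ 2 =
    \sum_i \sum_(j | j != i) \sum_k \sum_(l | l != k)
       g (c i) (c j) * g (c k) (c l).
  rewrite expr2 mulr_suml; apply: eq_bigr => i _; rewrite mulr_suml.
  apply: eq_bigr => j _; rewrite mulr_sumr; apply: eq_bigr => k _.
  by rewrite mulr_sumr.
rewrite (eq_mean E) mean_sum.
have -> : 2 * m%:R ^+ 2 * V = \sum_(i < m) \sum_(j < m) (2 * V).
  by rewrite !sumr_const !card_ord -mulrnA -[RHS]mulr_natl natrM; ring.
apply: ler_sum => i _; rewrite mean_sum big_mkcond /=.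
apply: ler_sum => j _; case: ifPn => [ji|_]; last by rewrite mulr_ge0.
have Vij k l : k != l -> mean (fun c => g (c k) (c l) ^+ 2) = V.
  by move=> kl; rewrite (mean_coord2 (fun x y => g x y ^+ 2)).
rewrite mean_sum (bigD1 i) //= (bigD1 j) //= big1 ?addr0; last first.
  move=> k /andP[ki kj]; rewrite mean_sum big1 // => l lk.
  under eq_mean => c do rewrite mulrC.
  by rewrite Efst // eq_sym.
rewrite !mean_sum (bigD1 j) //= big1 ?addr0; last first.
  move=> l /andP[li lj]; under eq_mean => c do rewrite mulrC gC.
  by rewrite Efst // eq_sym.
rewrite (bigD1 i) 1?eq_sym //= big1 ?addr0; last first.
  move=> l /andP[lj li]; under eq_mean => c do rewrite mulrC gC.
  by rewrite Efst // eq_sym.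
under eq_mean => c do rewrite -expr2.
rewrite Vij 1?eq_sym //.
under eq_mean => c do rewrite [g (c j) _]gC -expr2.
by rewrite Vij 1?eq_sym // mulr_natl mulr2n.
Qed.

(** Chebyshev's inequality, about an arbitrary centre [e]. *)
Lemma markov_sqr (F : {ffun 'I_m -> B} -> R) (b : pred {ffun 'I_m -> B})
  (e t : R) : 0 < t -> (forall c, b c -> t <= `|F c - e|) ->
  mean (fun c => (b c)%:R) <= mean (fun c => (F c - e) ^+ 2) / t ^+ 2.
Proof.
move=> t0 H; rewrite ler_pdivlMr ?exprn_gt0 // mulrC -meanZ.
apply: le_mean => c; case: (boolP (b c)) => [/H h|_]; last first.
  by rewrite mulr0 sqr_ge0.
rewrite mulr1 -[X in _ <= X]real_normK ?num_real //.
by rewrite lerXn2r // ?nnegrE // ltW.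
Qed.

Local Notation K := (#|B|%:R : R).

(** Squared distance of [p] to the uniform law. It is what the statistic
    estimates, after centring and division by [m ^ 2]. *)
Definition power_gap : R := \sum_x (p x - K^-1) ^+ 2.

Definition cell_chi2 c : R :=
  \sum_x ((\sum_i (c i == x)%:R) - m%:R / K) ^+ 2.

Definition cell_chi2_mean : R :=
  m%:R - m%:R / K + m%:R * (m%:R - 1) * power_gap.

Let K_gt0 : 0 < K.
Proof.
rewrite ltr0n lt0n; apply/negP => /eqP /card0_eq B0.
by move: p_sum1; rewrite big1 => [/eqP|x]; [rewrite eq_sym oner_eq0|have := B0 x].
Qed.

Let S2 := \sum_x p x ^+ 2.

Lemma power_gapE : power_gap = S2 - K^-1.
Proof.
rewrite /power_gap /S2.
under eq_bigr => x _ do rewrite sqrrB.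
rewrite big_split sumrB /= sumr_const sumrMnl -mulr_suml p_sum1 mul1r.
rewrite -/S2 -[_ *+ #|B|]mulr_natr; field; exact: lt0r_neq0.
Qed.

Lemma sum_delta (c : {ffun 'I_m -> B}) i j :
  \sum_x (c i == x)%:R * (c j == x)%:R = (c i == c j)%:R :> R.
Proof.
rewrite (bigD1 (c i)) //= eqxx mul1r big1 ?addr0 1?eq_sym // => x xc.
by rewrite eq_sym (negPf xc) mul0r.
Qed.

Lemma cell_chi2E c :
  cell_chi2 c = m%:R - m%:R ^+ 2 / K
    + \sum_i \sum_(j | j != i) (c i == c j)%:R.
Proof.
rewrite /cell_chi2.
under eq_bigr => x _ do rewrite sqrrB.
rewrite big_split sumrB /= sumr_const.
have -> : \sum_x (\sum_i (c i == x)%:R) ^+ 2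
   = m%:R + \sum_i \sum_(j | j != i) (c i == c j)%:R :> R.
  under eq_bigr => x _ do rewrite expr2 mulr_suml.
  have -> : m%:R = \sum_(i < m) 1 :> R by rewrite sumr_const card_ord.
  rewrite exchange_big /= -big_split /=.
  apply: eq_bigr => i _.
  under eq_bigr => x _ do rewrite mulr_sumr.
  rewrite exchange_big /= (bigD1 i) //=; congr (_ + _).
    by rewrite sum_delta eqxx.
  by apply: eq_bigr => j _; rewrite sum_delta.
have -> : \sum_x (\sum_i (c i == x)%:R) * (m%:R / K) *+ 2
   = m%:R ^+ 2 / K *+ 2 :> R.
  rewrite sumrMnl -mulr_suml exchange_big /=.
  under eq_bigr => i _ do (rewrite (bigD1 (c i)) //= eqxx big1 ?addr0; last
    by move=> x xc; rewrite eq_sym (negPf xc)).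
  by rewrite sumr_const card_ord expr2 mulrA.
by rewrite -[_ *+ #|B|]mulr_natr; field; exact: lt0r_neq0.
Qed.

(** Hoeffding's decomposition of the statistic: with [h x = p x - S2] and the
    degenerate kernel [g x y = [x = y] - p x - p y + S2], the centred
    statistic is [2 (m - 1) \sum_i h (c i) + \sum_(i != j) g (c i) (c j)], and
    each of the two parts has an explicit second moment. That [power_gap] is a
    factor of the term of order [m ^ 3] is what makes the bound useful under
    the alternative, where [power_gap] is the signal. *)
Lemma cell_chi2_variance_le M : 0 <= M -> (forall x, p x <= M / K) ->
  mean (fun c => (cell_chi2 c - cell_chi2_mean) ^+ 2) <=
  8 * m%:R ^+ 3 * (M / K) * power_gap + 4 * m%:R ^+ 2 * (M / K).
Proof.
move=> M0 pM.
have [m0|m0] := posnP m.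
  have -> : mean (fun c => (cell_chi2 c - cell_chi2_mean) ^+ 2) = 0.
    rewrite -[RHS](mean_cst 0); apply: eq_mean => c.
    rewrite cell_chi2E /cell_chi2_mean big1 ?m0 => [|i _]; first by field; exact: lt0r_neq0.
    by have := ltn_ord i; rewrite {2}m0.
  by rewrite m0 !expr0n /= !(mulr0, mul0r) addr0.
have MK0 : 0 <= M / K by rewrite divr_ge0 // ltW.
pose h x := p x - S2; pose g x y : R := (x == y)%:R - p x - p y + S2.
have ph0 : \sum_x p x * h x = 0.
  under eq_bigr => x _ do rewrite mulrBr -expr2.
  by rewrite sumrB -mulr_suml p_sum1 mul1r subrr.
have sum_eq y (u : B -> R) : \sum_x u x * (x == y)%:R = u y.
  rewrite (bigD1 y) //= eqxx mulr1 big1 ?addr0 // => x /negPf ->.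
  by rewrite mulr0.
have pg0 y : \sum_x p x * g x y = 0.
  rewrite (eq_bigr (fun x => p x * (x == y)%:R - p x ^+ 2 + p x * (S2 - p y))).
    rewrite big_split sumrB /= sum_eq -mulr_suml p_sum1 -/S2; ring.
  by move=> x _; rewrite /g; ring.
have gC x y : g x y = g y x by rewrite /g eq_sym; ring.
have S2M : S2 <= M / K.
  have -> : M / K = \sum_x p x * (M / K) by rewrite -mulr_suml p_sum1 mul1r.
  apply: ler_sum => x _.
  by rewrite expr2 ler_wpM2l.
(* the mean of [p] is closer to [p] in quadratic mean than [K^-1] *)
have hvar : \sum_x p x * h x ^+ 2 <= M / K * power_gap.
  apply: (@le_trans _ _ (\sum_x p x * (p x - K^-1) ^+ 2)).
    rewrite -subr_ge0 -sumrB.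
    have -> : \sum_x (p x * (p x - K^-1) ^+ 2 - p x * h x ^+ 2) =
        (S2 - K^-1) ^+ 2.
      rewrite (eq_bigr (fun x => p x * h x * (2 * (S2 - K^-1)) +
        p x * (S2 - K^-1) ^+ 2)) => [|x _]; last by rewrite /h; ring.
      by rewrite big_split /= -!mulr_suml ph0 p_sum1 mul0r add0r mul1r.
    exact: sqr_ge0.
  by rewrite /power_gap mulr_sumr; apply: ler_sum => x _; rewrite ler_wpM2r ?sqr_ge0.
have gvar : \sum_x \sum_y p x * p y * g x y ^+ 2 <= M / K.
  apply: le_trans S2M.
  have E x : \sum_y p x * p y * g x y ^+ 2 =
      p x ^+ 2 * (1 - 2 * p x + S2) - \sum_y p x * p y * p y * g x y.
    rewrite (eq_bigr (fun y => p x * p y * g x y * (y == x)%:R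
       - p x * (p x - S2) * (p y * g y x) - p x * p y * p y * g x y)).
      rewrite !sumrB sum_eq -mulr_sumr pg0; congr (_ - _).
      by rewrite /g eqxx mulr1n; ring.
    move=> y _; rewrite (gC y x) /g (eq_sym y x); ring.
  rewrite (eq_bigr _ (fun x _ => E x)) sumrB exchange_big /=.
  rewrite [X in _ - X]big1 ?subr0 => [|y _]; last first.
    rewrite (eq_bigr (fun x => p y ^+ 2 * (p x * g x y))).
      by rewrite -mulr_sumr pg0 mulr0.
    by move=> x _; ring.
  rewrite -subr_ge0.
  have -> : S2 - \sum_i p i ^+ 2 * (1 - 2 * p i + S2) =
      2 * (\sum_x p x * h x ^+ 2) + S2 ^+ 2.
    rewrite {1}/S2 -sumrB (eq_bigr (fun x => p x ^+ 2 * (2 * p x - S2))).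
      rewrite mulr_sumr [in RHS](eq_bigr (fun x => p x ^+ 2 * (2 * p x - S2) +
         S2 * (2 * S2 * p x - 3 * p x ^+ 2))) ?big_split /=; last first.
        by move=> x _; rewrite /h; ring.
      by rewrite -!mulr_sumr sumrB -!mulr_sumr p_sum1 -/S2; ring.
    by move=> x _; ring.
  rewrite addr_ge0 ?sqr_ge0 // mulr_ge0 // sumr_ge0 // => x _.
  by rewrite mulr_ge0 ?sqr_ge0.
have decomp c : cell_chi2 c - cell_chi2_mean =
    2 * (m%:R - 1) * (\sum_i h (c i)) +
    \sum_i \sum_(j | j != i) g (c i) (c j).
  have cstE i (a : R) : \sum_(j < m | j != i) a = (m%:R - 1) * a.
    by rewrite sumr_const cardC1 card_ord -[LHS]mulr_natl -subn1 natrB.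
  have offdiag (u : 'I_m -> R) :
      \sum_i \sum_(j | j != i) u j = (m%:R - 1) * \sum_i u i.
    rewrite (exchange_big_dep xpredT) //= mulr_sumr.
    apply: eq_bigr => j _; rewrite -(cstE j).
    by apply: eq_bigl => i; rewrite eq_sym.
  have -> : \sum_i \sum_(j | j != i) g (c i) (c j) =
      \sum_i \sum_(j | j != i) (c i == c j)%:R
      - 2 * (m%:R - 1) * (\sum_i p (c i)) + m%:R * (m%:R - 1) * S2.
    transitivity (\sum_i \sum_(j | j != i) (c i == c j)%:R
      - \sum_i \sum_(j | j != i) p (c i) - \sum_i \sum_(j | j != i) p (c j)
      + \sum_(i < m) \sum_(j < m | j != i) S2).
      rewrite -!sumrB -big_split; apply: eq_bigr => i _.
      by rewrite -!sumrB -big_split.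
    rewrite (offdiag (fun j => p (c j))).
    under [X in _ - X - _ + _]eq_bigr => i _ do rewrite cstE.
    under [X in _ - _ - _ + X]eq_bigr => i _ do rewrite cstE.
    by rewrite -mulr_sumr sumr_const card_ord -mulr_natl; ring.
  rewrite /h sumrB sumr_const card_ord cell_chi2E /cell_chi2_mean power_gapE.
  rewrite -mulr_natl; field; exact: lt0r_neq0.
have sqD (x y : R) : (x + y) ^+ 2 <= 2 * x ^+ 2 + 2 * y ^+ 2.
  by rewrite -subr_ge0 (_ : _ - _ = (x - y) ^+ 2) ?sqr_ge0 //; ring.
have := le_mean (fun c => (sqD (2 * (m%:R - 1) * (\sum_i h (c i)))
   (\sum_i \sum_(j | j != i) g (c i) (c j)))).
rewrite meanD !meanZ => Hle.
under eq_mean => c do rewrite decomp.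
apply: le_trans Hle _.
under eq_mean => c do rewrite exprMn.
rewrite meanZ mean_sqr_sum // lerD //.
  have m1 : (1 : R) <= m%:R by rewrite ler1n.
  have q : 2 * (2 * (m%:R - 1)) ^+ 2 * m%:R <= 8 * m%:R ^+ 3 :> R.
    by rewrite -subr_ge0 (_ : _ - _ = 8 * m%:R * (2 * m%:R - 1)) //; [nra|ring].
  rewrite -[leRHS]mulrA 2!mulrA; apply: ler_pM => //.
    by rewrite mulr_ge0 // mulr_ge0 // sqr_ge0.
  by apply: sumr_ge0 => x _; rewrite mulr_ge0 ?sqr_ge0.
apply: (@le_trans _ _ (2 * (2 * m%:R ^+ 2 *
    \sum_x \sum_y p x * p y * g x y ^+ 2))).
  by rewrite ler_wpM2l // mean_sqr_degenerate_le.
rewrite [leLHS]mulrA [2 * (2 * _)]mulrA (_ : 2 * 2 = 4 :> R); last by ring.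
by apply: ler_wpM2l => //; rewrite mulr_ge0 // sqr_ge0.
Qed.
End independent_cells.

(** * Lagrange interpolation and Taylor approximation on an interval *)

Section line_interpolation.
Context {R : realType}.
Implicit Types (F G : R -> R) (T t : R) (q : {poly R}).

(** Distinct integer nodes are at distance at least one, so the Lagrange weights
    are bounded uniformly in the point [t]. *)
Lemma interpolation_weights (l N o : nat) t :
  exists w : 'I_l.+1 -> R,
    (forall q, (size q <= l.+1)%N ->
       q.[t] = \sum_r w r * q.[(o + r)%:R]) /\
    ((o + l <= N)%N -> 0 <= t <= N%:R ->
       \sum_r `|w r| <= l.+1%:R * N%:R ^+ l).
Proof.
pose x (j : nat) : R := (o + j)%:R.
have x_inj : injective x.
  by move=> i j /(can_inj (@natrK R)) /addnI.
pose la (i : 'I_l.+1) : {poly R} := tnth (lagrange l.+1 x) i.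
exists (fun i => (la i).[t]); split.
  move=> q /(lagrange_gen (ltn0Sn l) x_inj) {1}->.
  rewrite horner_sum; apply: eq_bigr => i _.
  by rewrite hornerM hornerC mulrC.
move=> oN /andP[t0 tN].
rewrite -[l.+1 in leRHS]card_ord mulr_natl -sumr_const; apply: ler_sum => i _.
rewrite /la lagrangeE // hornerM hornerC normrM normrV ?unitfE; last first.
  rewrite horner_prod; apply/prodf_neq0 => j ji.
  by rewrite hornerXsubC subr_eq0 (inj_eq x_inj) eq_sym.
rewrite !horner_prod !normr_prod mulrC ler_pdivrMr; last first.
  apply: prodr_gt0 => j ji.
  by rewrite hornerXsubC normr_gt0 subr_eq0 (inj_eq x_inj) eq_sym.
apply: (@le_trans _ _ (\prod_(j < l.+1 | j != i) N%:R)).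
  apply: ler_prod => j _; rewrite normr_ge0 /= hornerXsubC ler_distlC.
  have := ltn_ord j; rewrite ltnS => jl.
  have xN : x j <= N%:R by rewrite /x ler_nat (leq_trans _ oN) // leq_add2l.
  have x0 : 0 <= x j by rewrite /x.
  by apply/andP; split; lra.
rewrite prodr_const cardC1 card_ord /=.
rewrite ler_peMr ?exprn_ge0 //.
rewrite -[leLHS](@prodr_const_nat _ 1 0 0) big_geq //.
apply: (big_ind (fun y => 1 <= y)) => // [y z|j ji]; first exact: mulr_ege1.
rewrite hornerXsubC /x.
have: (i : nat) != j by rewrite eq_sym.
rewrite neq_ltn => /orP[ij|ij].
  rewrite distrC -natrB ?leq_add2l ?(ltnW ij) // subnDl normr_nat ler1n subn_gt0 //.
by rewrite -natrB ?leq_add2l ?(ltnW ij) // subnDl normr_nat ler1n subn_gt0.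
Qed.

(** Differentiability on a closed interval, one-sided at its ends, which is
    what differentiability relative to the cube gives along a segment. *)
Definition derivative_upto T F F' := forall t, 0 <= t <= T ->
  forall e : R, 0 < e -> exists2 r : R, 0 < r & forall t', 0 <= t' <= T ->
    `|t' - t| < r -> `|F t' - F t - (t' - t) * F' t| <= e * `|t' - t|.

(** The mean value theorem for [F - q]. Outside of the interval [F] is
    prolonged by constants, which makes it continuous on the whole line. *)
Lemma le_increment_upto T F F' q (E : R) : derivative_upto T F F' ->
  (forall t, 0 <= t <= T -> `|F' t - q^`().[t]| <= E) ->
  forall t, 0 <= t <= T -> `|F t - q.[t] - (F 0 - q.[0])| <= E * t.
Proof.
move=> dF FE t /andP[t0 tT].
have T0 : 0 <= T := le_trans t0 tT.
pose clamp (u : R) := Num.max 0 (Num.min u T).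
have clampP u : 0 <= clamp u <= T.
  by rewrite /clamp le_max lexx /= ge_max T0 ge_min lexx orbT.
have clampE u : 0 <= u <= T -> clamp u = u.
  by move=> /andP[u0 uT]; rewrite /clamp min_l // max_r.
have clamp_lip u v : `|clamp u - clamp v| <= `|u - v|.
  have minL x y : `|Num.min x T - Num.min y T| <= `|x - y|.
    have xy := ler_norm (x - y); have yx := ler_norm (y - x).
    rewrite distrC in yx; rewrite ler_norml; apply/andP.
    by case: (ltP x T) => ?; case: (ltP y T) => ?; split; lra.
  rewrite /clamp; apply: le_trans (minL u v); move: (Num.min u T) (Num.min v T) => x y.
  have xy := ler_norm (x - y); have yx := ler_norm (y - x).
  rewrite distrC in yx; rewrite ler_norml; apply/andP.
  by case: (ltP 0 x) => ?; case: (ltP 0 y) => ?; split; lra.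
pose G u := F (clamp u).
have cG : continuous G.
  move=> u; apply/cvgrPdist_lt => e e0.
  have [r r0 rF] := dF _ (clampP u) 1 ltr01.
  pose C := 1 + `|F' (clamp u)|.
  have C0 : 0 < C by rewrite ltr_pwDl.
  near=> v.
  have uv : `|clamp v - clamp u| < r.
    apply: le_lt_trans (clamp_lip _ _) _; rewrite distrC; near: v.
    exact: (@nbhsx_ballx _ R^o u r r0).
  have h := rF _ (clampP v) uv.
  have h2 : `|G v - G u| <= C * `|clamp v - clamp u|.
    rewrite /G -[X in `|X|](subrK ((clamp v - clamp u) * F' (clamp u))).
    rewrite (le_trans (ler_normD _ _)) // /C [leRHS]mulrDl lerD //.
    by rewrite normrM mulrC.
  rewrite distrC (le_lt_trans h2) // -ltr_pdivlMl //.
  apply: le_lt_trans (clamp_lip _ _) _; rewrite distrC; near: v.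
  by apply: (@nbhsx_ballx _ R^o u); rewrite mulr_gt0 // invr_gt0.
have dG u : u \in `]0, t[ -> is_derive u 1 (fun v => G v - q.[v]) (F' u - q^`().[u]).
  rewrite in_itv /= => /andP[u0 ut].
  have uT : 0 <= u <= T by rewrite ltW //= ltW // (lt_le_trans ut).
  suff dGu : is_derive u 1 G (F' u).
    exact: (is_deriveB dGu (is_derive_poly q u)).
  have lim : h^-1 *: (G (h *: (1 : R) + u) - G u) @[h --> (0:R)^'] --> F' u.
    apply/cvgrPdist_le => e e0.
    have [r r0 rF] := dF _ uT _ e0.
    near=> h.
    have h0 : h != 0 by near: h; exact: nbhs_dnbhs_neq.
    have hr : `|h| < Num.min r (Num.min u (t - u)).
      near: h; apply: dnbhs0_lt; rewrite !lt_min r0 u0 /= subr_gt0 //.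
    move: hr; rewrite !lt_min => /and3P[hr hu htu].
    have huT : 0 <= h + u <= T.
      by move: hu htu; rewrite !ltr_norml => /andP[? ?] /andP[? ?]; apply/andP; split; lra.
    have := rF _ huT; rewrite addrK => /(_ hr) Hh.
    rewrite scaler1 /G !clampE // distrC.
    have -> : h^-1 *: (F (h + u) - F u) - F' u =
              (F (h + u) - F u - h * F' u) / h.
      by rewrite /GRing.scale /=; field.
    by rewrite normrM normfV ler_pdivrMr ?normr_gt0.
  by apply: DeriveDef; [apply/cvg_ex; exists (F' u)|apply: cvg_lim].
have cGq : {within `[0, t], continuous (fun v => G v - q.[v])}.
  apply: continuous_subspaceT => v.
  by apply: cvgB; [exact: cG|exact: continuous_horner].
have [c ct] := MVT_segment t0 dG cGq.
rewrite /G !clampE ?lexx ?t0 ?tT //.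
rewrite subr0 => ->; rewrite normrM (ger0_norm t0) ler_wpM2r //.
apply: FE; move: ct; rewrite in_itv /= => /andP[-> ct] /=.
exact: le_trans tT.
Unshelve. all: by end_near.
Qed.

Definition antideriv q : {poly R} := \poly_(i < (size q).+1) (q`_i.-1 / i%:R).

Lemma deriv_antideriv q : (antideriv q)^`() = q.
Proof.
apply/polyP => i; rewrite coef_deriv coef_poly ltnS /=.
case: ltnP => [_|qi]; first by rewrite -[LHS]mulr_natr mulfVK // pnatr_eq0.
by rewrite mul0rn nth_default.
Qed.

Lemma size_antideriv q : (size (antideriv q) <= (size q).+1)%N.
Proof. exact: size_poly. Qed.

(** Taylor's formula in the form that is used below: the approximating
    polynomial is built by repeated integration, and the error by repeated use
    of the mean value theorem. *)
Lemma taylor_poly T (l : nat) (F : nat -> R -> R) (E : R) : 0 <= T ->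
  (forall k, (k < l)%N -> derivative_upto T (F k) (F k.+1)) ->
  (forall t, 0 <= t <= T -> `|F l t - F l 0| <= E) ->
  exists2 q : {poly R}, (size q <= l.+1)%N &
    forall t, 0 <= t <= T -> `|F 0%N t - q.[t]| <= E * T ^+ l.
Proof.
move=> T0; elim: l F => [|l IHl] F dF FE.
  exists (F 0%N 0)%:P; first by rewrite size_polyC leq_b1.
  by move=> t tT; rewrite hornerC expr0 mulr1 FE.
have [k kl|t tT|q sq qF] := IHl (fun k => F k.+1).
- exact: dF.
- exact: FE.
exists (antideriv q + (F 0%N 0 - (antideriv q).[0])%:P).
  rewrite (leq_trans (size_polyD _ _)) // geq_max.
  rewrite (leq_trans (size_antideriv q)) ?ltnS //.
  by rewrite (leq_trans (size_polyC_leq1 _)).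
move=> t tT; rewrite hornerD hornerC opprD addrA.
have ET0 : 0 <= E * T ^+ l by apply: le_trans (qF 0 _); rewrite ?lexx ?T0.
apply: (@le_trans _ _ (E * T ^+ l * t)).
  apply: (le_increment_upto (dF 0%N (ltn0Sn _)) _ tT) => u uT.
  by rewrite deriv_antideriv qF.
by move/andP: tT => [_ tT]; rewrite exprSr mulrA ler_wpM2l.
Qed.

End line_interpolation.

(** * Holder functions along segments *)

Section holder_along_lines.
Context {R : realType} {d : nat}.
Implicit Types (x y v w : 'rV[R]_d) (f : 'rV[R]_d -> R).

Lemma enorm_ge0 x : 0 <= enorm x.
Proof. exact: sqrtr_ge0. Qed.

Lemma enormZ (a : R) x : enorm (a *: x) = `|a| * enorm x.
Proof.
rewrite /enorm; under eq_bigr => i _ do rewrite mxE exprMn.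
by rewrite -mulr_sumr sqrtrM ?sqr_ge0 // sqrtr_sqr.
Qed.

Lemma enorm_le_dim x (c : R) : 0 <= c -> (forall i, `|x ord0 i| <= c) ->
  enorm x <= c * d%:R.
Proof.
move=> c0 xc; have cd0 : 0 <= c * d%:R by rewrite mulr_ge0.
rewrite -(ger0_norm cd0) -sqrtr_sqr ler_sqrt ?sqr_ge0 //.
apply: (@le_trans _ _ (\sum_(i < d) c ^+ 2)).
  apply: ler_sum => i _; rewrite -real_normK ?num_real // lerXn2r ?nnegrE //.
rewrite sumr_const card_ord exprMn -[leLHS]mulr_natr ler_wpM2l ?sqr_ge0 //.
by rewrite -natrX ler_nat; case: (d) => // n; rewrite leq_pmulr.
Qed.

Lemma enorm_delta (i : 'I_d) : enorm (delta_mx ord0 i : 'rV[R]_d) = 1.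
Proof.
rewrite /enorm (bigD1 i) //= big1 => [|j ji]; last first.
  by rewrite mxE (negPf ji) andbF expr0n.
by rewrite mxE !eqxx expr1n addr0 sqrtr1.
Qed.

Lemma opnorm_le k (T : kform R d k) (c : R) (v : k.-tuple 'rV[R]_d) :
  (opnorm T <= c%:E)%E -> (forall i, enorm (tnth v i) <= 1) -> `|T v| <= c.
Proof.
move=> Tc v1; rewrite -lee_fin; apply: le_trans Tc.
by apply: ereal_sup_ubound; exists v.
Qed.

Lemma multilinear_cons k (T : kform R d k.+1) (a : R) w :
  multilinear T ->
  T (cons_tuple (a *: w) [tuple w | i < k]) = a * T [tuple w | i < k.+1].
Proof.
move=> /(_ ord0 [tuple w | i < k.+1]).
set h := fun u : 'rV[R]_d => _ => hlin.
have hE u : h u = T (cons_tuple u [tuple w | i < k]).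
  rewrite /h; congr T; apply: eq_from_tnth => i; rewrite !tnth_mktuple.
  by case: (unliftP ord0 i) => [j ->|->]; rewrite /= ?tnth0 // tnthS tnth_mktuple.
have h0 : h 0 = 0.
  have := hlin 1 0 0; rewrite scale1r addr0 mul1r => /eqP.
  by rewrite -subr_eq0 opprD addrA subrr sub0r oppr_eq0 => /eqP.
have := hlin a w 0; rewrite !addr0 h0 addr0 hE => ->; congr (_ * _).
by rewrite hE; congr T; apply: eq_from_tnth => i; rewrite !tnth_mktuple;
  case: (unliftP ord0 i) => [j ->|->]; rewrite ?tnth0 // tnthS tnth_mktuple.
Qed.

Lemma unit_cube_convex x v (T t : R) : unit_cube x -> unit_cube (x + T *: v) ->
  0 <= t <= T -> unit_cube (x + t *: v).
Proof.
move=> cx cT /andP[t0 tT] i.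
move: (cx i) (cT i); rewrite !in_itv /= !mxE.
move: (x ord0 i) (v ord0 i) => a b /andP[a0 a1] /andP[b0 b1].
case: (lerP 0 b) => b2; apply/andP; split; nra.
Qed.

(** Along a segment, a function of the class agrees with a polynomial of degree
    [strict_floor s] up to the length of the segment to the power [s]: the
    [k]-th derivative of [t |-> f (x + t v)] is the [k]-th derivative of [f]
    evaluated on the diagonal [(v, ..., v)], so one-dimensional Taylor
    expansion applies. *)
Lemma holder_segment (s L : R) f x v (T c : R) : 0 < s -> 0 <= L ->
  holder s L f -> unit_cube x -> unit_cube (x + T *: v) ->
  0 < T -> 0 < c -> enorm v <= c ->
  exists2 q : {poly R}, (size q <= (strict_floor s).+1)%N &
    forall t, 0 <= t <= T -> `|f (x + t *: v) - q.[t]| <= L * (T * c) `^ s.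
Proof.
move=> s0 L0 [D /=]; set l := strict_floor s => -[[D0 Dlin Dder] DHold _].
move=> cx cxT T0 c0 vc.
pose w := c^-1 *: v.
have w1 : enorm w <= 1.
  by rewrite /w enormZ gtr0_norm ?invr_gt0 // ler_pdivrMl // mulr1.
have vE : v = c *: w by rewrite scalerA divff ?scale1r // gt_eqF.
have wk1 k i : enorm (tnth [tuple w | _ < k] i) <= 1 by rewrite tnth_mktuple.
pose z t := x + t *: v.
have cz t : 0 <= t <= T -> unit_cube (z t) by exact: unit_cube_convex.
pose F k t := c ^+ k * D k (z t) [tuple w | _ < k].
have F0 t : 0 <= t <= T -> f (z t) = F 0%N t.
  move=> tT; rewrite /F expr0 mul1r -(D0 _ (cz _ tT)); congr D.
  by apply: eq_from_tnth => -[].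
have dF k : (k < l)%N -> derivative_upto T (F k) (F k.+1).
  move=> kl t tT e e0.
  have e'0 : 0 < e / c ^+ k.+1 by rewrite divr_gt0 ?exprn_gt0.
  have /nbhs_ballP[r /= r0 rD] := Dder k (z t) kl (cz _ tT) _ e'0.
  exists (r / (1 + `|v|)); first by rewrite divr_gt0 // ltr_pwDl.
  move=> t' t'T t't.
  have zE : z t' - z t = (t' - t) *: v.
    by rewrite /z opprD addrACA subrr add0r scalerBl.
  have zr : ball (z t) r (z t').
    rewrite -ball_normE /ball_ /= distrC zE normrZ.
    move: t't; rewrite ltr_pdivlMr ?ltr_pwDl //; apply: le_lt_trans.
    by rewrite ler_wpM2l // lerDr.
  have := opnorm_le (rD _ zr (cz _ t'T)) (@wk1 k).
  rewrite zE [in cons_tuple _ _]vE scalerA multilinear_cons; last first.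
    exact: Dlin (cz _ tT).
  move=> H; rewrite /F.
  rewrite (_ : _ - _ - _ = c ^+ k * (D k (z t') [tuple w | _ < k] -
     D k (z t) [tuple w | _ < k] -
     (t' - t) * c * D k.+1 (z t) [tuple w | _ < k.+1])); last first.
    by rewrite exprS; ring.
  rewrite normrM gtr0_norm ?exprn_gt0 // -ler_pdivlMl ?exprn_gt0 //.
  apply: (le_trans H); rewrite enormZ.
  apply: (@le_trans _ _ (e / c ^+ k.+1 * (`|t' - t| * c))).
    by rewrite !ler_wpM2l // ltW.
  by rewrite exprS le_eqVlt; apply/orP; left; apply/eqP; field; rewrite !gt_eqF ?exprn_gt0.
have Tc0 : 0 < T * c by rewrite mulr_gt0.
have [sl ls] : l%:R < s /\ 0 <= s - l%:R.
  by have /andP[h _] := strict_floorP s0; rewrite subr_ge0 ltW.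
have HF t : 0 <= t <= T -> `|F l t - F l 0| <= c ^+ l * (L * (T * c) `^ (s - l%:R)).
  move=> tT; have zT0 : 0 <= (0:R) <= T by rewrite lexx ltW.
  rewrite -mulrBr normrM gtr0_norm ?exprn_gt0 // ler_pM2l ?exprn_gt0 //.
  have := opnorm_le (DHold _ _ (cz _ tT) (cz _ zT0)) (@wk1 l).
  move=> /le_trans; apply; rewrite ler_wpM2l //.
  have -> : z t - z 0 = t *: v by rewrite /z scale0r addr0 addrC addKr.
  rewrite enormZ; case/andP: tT => t0 tT; rewrite ger0_norm //.
  by apply: ge0_ler_powR; rewrite ?nnegrE ?mulr_ge0 ?enorm_ge0 ?ler_pM ?(ltW T0) ?(ltW c0) ?enorm_ge0.
have [q sq qF] := taylor_poly (ltW T0) dF HF.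
exists q => // t tT; rewrite -/(z t) F0 //; apply: le_trans (qF _ tT) _.
have -> : (T * c) `^ s = (T * c) `^ (s - l%:R) * (T ^+ l * c ^+ l).
  rewrite -exprMn -powR_mulrn ?(ltW Tc0) // -powRD ?subrK //.
  by apply/implyP => _; rewrite gt_eqF.
by rewrite le_eqVlt; apply/orP; left; apply/eqP; ring.
Qed.

(** Weights that are exact on polynomials lose nothing but the polynomial
    approximation error, at [t] and at the nodes. *)
Lemma holder_interpolation (s L : R) f x v (T c : R) (n : nat)
    (wt node : 'I_n -> R) t :
  0 < s -> 0 <= L -> holder s L f -> unit_cube x -> unit_cube (x + T *: v) ->
  0 < T -> 0 < c -> enorm v <= c ->
  0 <= t <= T -> (forall r, 0 <= node r <= T) ->
  (forall q : {poly R}, (size q <= (strict_floor s).+1)%N ->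
     q.[t] = \sum_r wt r * q.[node r]) ->
  `|f (x + t *: v) - \sum_r wt r * f (x + node r *: v)|
    <= (1 + \sum_r `|wt r|) * (L * (T * c) `^ s).
Proof.
move=> s0 L0 Hf cx cxT T0 c0 vc tT nT wtP.
have [q sq qf] := holder_segment s0 L0 Hf cx cxT T0 c0 vc.
have -> : f (x + t *: v) - \sum_r wt r * f (x + node r *: v) =
    (f (x + t *: v) - q.[t]) +
    \sum_r wt r * (q.[node r] - f (x + node r *: v)).
  under [in RHS]eq_bigr => r _ do rewrite mulrBr.
  by rewrite sumrB -wtP // addrA subrK.
rewrite (le_trans (ler_normD _ _)) // mulrDl mul1r lerD ?qf //.
rewrite mulr_suml (le_trans (ler_norm_sum _ _ _)) //.
by apply: ler_sum => r _; rewrite normrM ler_wpM2l // distrC qf.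
Qed.

Lemma holder_bounded (s L : R) f x : holder s L f -> unit_cube x ->
  `|f x| <= L.
Proof.
move=> [D /= [[D0 _ _] _ DL]] cx; rewrite -D0 //.
by apply: opnorm_le (DL 0%N x _ cx) _ => // -[].
Qed.

End holder_along_lines.

(** * Lebesgue measure on R^d under dilations *)

Section lebesgue_cube.
Context {R : realType} {d : nat}.
Implicit Types (x y a : 'rV[R]_d) (f : 'rV[R]_d -> R) (A D : set 'rV[R]_d).

Local Notation mu := (@lebesgue_rV R d).

Lemma measurable_box (I : 'I_d -> set R) : (forall i, measurable (I i)) ->
  measurable [set x : 'rV[R]_d | forall i, I i (x ord0 i)].
Proof.
move=> mI.
rewrite [X in measurable X](_ : _ = \bigcap_(i in [set: 'I_d])
  (fun x : 'rV[R]_d => x ord0 i) @^-1` I i).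
  apply: fin_bigcap_measurable => // i _.
  by rewrite -[X in measurable X]setTI; exact: measurable_coord.
by apply/seteqP; split=> x h i; [move=> _|]; exact: h.
Qed.

Definition boxes : set (set 'rV[R]_d) :=
  [set A | exists2 I : 'I_d -> set R, (forall i, measurable (I i)) &
     A = [set x : 'rV[R]_d | forall i, I i (x ord0 i)]].

(** Boxes are stable under intersection, so two measures that agree on them
    are equal. *)
Lemma measurable_boxes : measurable = <<s boxes >>.
Proof.
apply/seteqP; split => [A|A]; last first.
  apply: smallest_sub; first exact: sigma_algebra_measurable.
  by move=> _ [I mI ->]; exact: measurable_box.
rewrite /measurable /=; apply: smallest_sub; first exact: smallest_sigma_algebra.
move=> B; rewrite -bigcup_seq => -[i _ [I mI <-]].
apply: sub_sigma_algebra; exists (fun j => if j == i then I else setT).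
  by move=> j; case: ifP.
apply/seteqP; split=> x /=.
  by move=> [_ Ix] j; case: eqP => [->|].
by move=> /(_ i); rewrite eqxx.
Qed.

Lemma measurable_affine a (c : R) :
  measurable_fun [set: 'rV[R]_d] (fun x => a + c *: x).
Proof.
move=> _ B mB; rewrite setTI.
have {mB} : <<s boxes >> B by rewrite -measurable_boxes.
have mpre : sigma_algebra setT
    [set B | measurable ((fun x : 'rV[R]_d => a + c *: x) @^-1` B)].
  split => /=; first by rewrite preimage_set0.
    by move=> C mC; rewrite setTD preimage_setC; exact: measurableC.
  by move=> F mF; rewrite preimage_bigcup; exact: bigcup_measurable.
move: B; apply: smallest_sub => //; move=> _ [I mI ->] /=.
rewrite [X in measurable X](_ : _ = [set x : 'rV[R]_d | forall i,
   ((fun u => a ord0 i + c * u) @^-1` I i) (x ord0 i)]); last first.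
  by apply/seteqP; split => x /= h i; have := h i; rewrite !mxE.
apply: (@measurable_box (fun i => (fun u => a ord0 i + c * u) @^-1` I i)) => i.
rewrite -[X in measurable X]setTI.
suff h : measurable_fun [set: R] (fun u => a ord0 i + c * u) by exact: h.
by apply: measurable_funD => //; exact: measurable_funM.
Qed.

Lemma lebesgue_measure_scale (b c : R) (A : set R) : 0 < c -> measurable A ->
  lebesgue_measure A =
  (c%:E * lebesgue_measure ((fun u => (b + c * u)%R) @^-1` A))%E.
Proof.
move=> c0 mA.
pose phi : measurableTypeR R -> measurableTypeR R := fun u : R => b + c * u.
have mphi : measurable_fun [set: measurableTypeR R] phi.
  by apply: measurable_funD => //; exact: measurable_funM.
pose nu : {measure set (measurableTypeR R) -> \bar R} :=
  mscale (NngNum (ltW c0))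
    (measure_function_pushforward__canonical__measure_function_Measure
       lebesgue_measure mphi).
have -> : (c%:E * lebesgue_measure ((fun u => (b + c * u)%R) @^-1` A))%E = nu A.
  by [].
apply: lebesgue_measure_unique => // _ [[u v] _ <-] /=.
rewrite -[RHS]/(c%:E * lebesgue_measure (phi @^-1` `]u, v]))%E.
have -> : phi @^-1` `]u, v] = `](u - b) / c, (v - b) / c]%classic.
  apply/seteqP; split => x /=; rewrite !in_itv /= ltr_pdivrMr // ler_pdivlMr //.
    by rewrite ltrBlDl lerBrDl (mulrC x).
  by rewrite ltrBlDl lerBrDl (mulrC x).
rewrite !lebesgue_measure_itv /= !lte_fin ltr_pM2r ?invr_gt0 //.
rewrite ltrBlDr subrK; case: ifPn => uv; last by rewrite mule0.
by rewrite -!EFinB -EFinM; congr _%:E; field; exact: lt0r_neq0.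
Qed.

Lemma prodEFin (I : finType) (F : I -> R) :
  (\prod_i (F i)%:E = (\prod_i F i)%:E)%E.
Proof. by rewrite -(big_morph EFin EFinM erefl). Qed.

Lemma lebesgue_rV_scale a (c : R) A : 0 < c -> measurable A ->
  mu A = ((c ^+ d)%:E * mu ((fun u => (a + c *: u)%R) @^-1` A))%E.
Proof.
move=> c0 mA; have c0d : 0 <= c ^+ d by rewrite exprn_ge0 ?ltW.
pose nu : {measure set 'rV[R]_d -> \bar R} :=
  mscale (NngNum c0d)
    (measure_function_pushforward__canonical__measure_function_Measure
       mu (measurable_affine a c)).
have -> : ((c ^+ d)%:E * mu ((fun u => (a + c *: u)%R) @^-1` A))%E = nu A by [].
pose g (n : nat) : set 'rV[R]_d :=
  [set x | forall i, `[- n%:R, n%:R]%classic (x ord0 i)].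
apply: (measure_unique boxes g) => //.
- exact: measurable_boxes.
- move=> _ _ [I mI ->] [J mJ ->]; exists (fun i => I i `&` J i).
    by move=> i; exact: measurableI.
  apply/seteqP; split => x /=.
    by move=> [h1 h2] i; split; [exact: h1|exact: h2].
  by move=> h; split => i; have [] := h i.
- by move=> n; exists (fun=> `[- n%:R, n%:R]%classic).
- apply/seteqP; split => // x _.
  exists (\max_(i < d) (Num.truncn `|x ord0 i|).+1) => // i /=.
  rewrite in_itv /= -ler_norml ltW // (lt_le_trans (truncnS_gt _)) // ler_nat.
  exact: (@leq_bigmax _ (fun i => (Num.truncn `|x ord0 i|).+1)).
- move=> _ [I mI ->].
  transitivity (\prod_(i < d) lebesgue_measure (I i))%E.
    exact: lebesgue_rV_box.
  rewrite -[RHS]/(_ * mu (_ @^-1` _))%E.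
  rewrite (_ : _ @^-1` _ = [set x : 'rV[R]_d | forall i,
     ((fun u => a ord0 i + c * u) @^-1` I i) (x ord0 i)]); last first.
    by apply/seteqP; split => x /= h i; have := h i; rewrite !mxE.
  rewrite (@lebesgue_rV_box _ _ (fun i => (fun u => a ord0 i + c * u) @^-1` I i)); last first.
    move=> i; rewrite -[X in measurable X]setTI.
    suff h : measurable_fun [set: R] (fun u => a ord0 i + c * u) by exact: h.
    by apply: measurable_funD => //; exact: measurable_funM.
  have -> : (NngNum c0d)%:num = \prod_(i < d) c.
    by rewrite prodr_const card_ord.
  rewrite -prodEFin -big_split /=.
  by apply: eq_bigr => i _; exact: lebesgue_measure_scale.
- move=> n.
  have gE : mu (g n) = (\prod_(i < d) lebesgue_measure `[(- n%:R)%R, n%:R%R]%classic)%E.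
    by rewrite -lebesgue_rV_box.
  rewrite -[X in (X < _)%E]/(mu (g n)) gE (eq_bigr (fun=> (n%:R - - n%:R)%:E)) ?prodEFin ?ltry // => i _.
  rewrite lebesgue_measure_itv /= lte_fin EFinB; case: ifPn => //.
  rewrite -leNgt => nn; congr _%:E.
  have : (0:R) <= n%:R by []. lra.
Qed.

Lemma ge0_integral_rV_scale a (c : R) A (F : 'rV[R]_d -> \bar R) : 0 < c ->
  measurable A -> measurable_fun A F -> (forall x, A x -> 0 <= F x)%E ->
  (\int[mu]_(x in A) F x = (c ^+ d)%:E *
   \int[mu]_(u in (fun u => (a + c *: u)%R) @^-1` A) F (a + c *: u)%R)%E.
Proof.
move=> c0 mA mF F0; have c0d : 0 <= c ^+ d by rewrite exprn_ge0 ?ltW.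
rewrite -(ge0_integral_pushforward (measurable_affine a c) mu mA mF); last first.
  by move=> x; rewrite inE; exact: F0.
rewrite -[c ^+ d]/((NngNum c0d)%:num) -(ge0_integral_mscale _ mA _ _ F0) //.
  exact: measurable_affine.
by move=> ?; apply: eq_measure_integral => B mB _; exact: lebesgue_rV_scale.
Qed.

End lebesgue_cube.

Section integral_over_cells.
Context {disp : measure_display} {T : measurableType disp} {R : realType}.
Variable mu : {measure set T -> \bar R}.

Lemma measure_bigsetU_fin (I : finType) (E : I -> set T) :
  (forall i, measurable (E i)) -> trivIset setT E ->
  mu (\big[setU/set0]_i E i) = (\sum_i mu (E i))%E.
Proof.
move=> mE tE; have mU : measurable (\big[setU/set0]_i E i).
  exact: bigsetU_measurable.
have mass A : measurable A -> mu A = (\int[mu]_(x in A) (cst 1 x))%E.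
  by move=> mA; rewrite integral_cst // mul1e.
rewrite mass // ge0_integral_bigsetU ?index_enum_uniq //.
  by apply: eq_bigr => i _; rewrite -mass.
exact: sub_trivIset tE.
Qed.

Lemma negligible_setD_cells (I : finType) (E : I -> set T) (D : set T) :
  measurable D -> (forall i, measurable (E i)) -> (forall i, E i `<=` D) ->
  trivIset setT E -> mu D = (\sum_i mu (E i))%E -> (mu D < +oo)%E ->
  mu (D `\` \big[setU/set0]_i E i) = 0%E.
Proof.
move=> mD mE ED tE muD muDoo.
have mU : measurable (\big[setU/set0]_i E i) by exact: bigsetU_measurable.
have sub : \big[setU/set0]_i E i `<=` D.
  by apply: (big_ind (fun A => A `<=` D)) => // A B sA sB x [/sA|/sB].
have muU : mu (\big[setU/set0]_i E i) = mu D by rewrite measure_bigsetU_fin.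
transitivity (mu D - mu (\big[setU/set0]_i E i))%E.
  by rewrite -[in X in (_ - X)%E](setIidr sub); exact: measureD.
by rewrite muU subee // ge0_fin_numE.
Qed.

Lemma ge0_integral_cells (I : finType) (E : I -> set T) (D : set T)
    (F : T -> \bar R) :
  measurable D -> (forall i, measurable (E i)) -> trivIset setT E ->
  mu (D `\` \big[setU/set0]_i E i) = 0%E ->
  measurable_fun D F -> (forall x, D x -> 0 <= F x)%E ->
  (\int[mu]_(x in D) F x = \sum_i \int[mu]_(x in D `&` E i) F x)%E.
Proof.
move=> mD mE tE mu0 mF F0.
have mU : measurable (\big[setU/set0]_i E i) by exact: bigsetU_measurable.
rewrite (ge0_negligible_integral _ mD mF F0 mu0); last exact: measurableD.
rewrite setDD big_distrr /=.
have mDU : measurable (\big[setU/set0]_i (D `&` E i)).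
  by apply: bigsetU_measurable => i _; exact: measurableI.
have sub : \big[setU/set0]_i (D `&` E i) `<=` D.
  by rewrite -big_distrr /=; exact: subIsetl.
rewrite ge0_integral_bigsetU ?index_enum_uniq //.
- by move=> i; exact: measurableI.
- move=> i j _ _ [x [[_ Ei] [_ Ej]]]; apply: tE => //; by exists x.
- exact: measurable_funS mF.
- by move=> x /sub; exact: F0.
Qed.

End integral_over_cells.

(** * Bins, and densities averaged over corner boxes *)

Section bins.
Context {R : realType} {d : nat}.
Implicit Types (x y u : 'rV[R]_d) (f : 'rV[R]_d -> R) (b : 'I_d -> nat).
Variable kappa : nat.
Hypothesis kappa_gt0 : (0 < kappa)%N.

Local Notation mu := (@lebesgue_rV R d).
Local Notation cube := (@unit_cube R d).

Let k0 : 0 < kappa%:R :> R. Proof. by rewrite ltr0n. Qed.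

Definition bin (k : d.-tuple 'I_kappa) : set 'rV[R]_d := [set x | in_bin k x].

Lemma binP (k : d.-tuple 'I_kappa) x :
  bin k x <-> forall i, (tnth k i)%:R < kappa%:R * x ord0 i <= (tnth k i).+1%:R.
Proof.
have E i : x ord0 i \in `](tnth k i)%:R / kappa%:R, (tnth k i).+1%:R / kappa%:R]
  = ((tnth k i)%:R < kappa%:R * x ord0 i <= (tnth k i).+1%:R).
  by rewrite in_itv /= ltr_pdivrMr // ler_pdivlMr // mulrC.
split=> [/forallP h i|h]; first by rewrite -E; exact: h.
by apply/forallP => i; rewrite E.
Qed.

Lemma bin_box (k : d.-tuple 'I_kappa) :
  bin k = [set x | forall i, `](tnth k i)%:R / kappa%:R,
                              (tnth k i).+1%:R / kappa%:R]%classic (x ord0 i)].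
Proof.
apply/seteqP; split => x /=; first by move=> /forallP h i; exact: h.
by move=> h; apply/forallP => i; exact: h.
Qed.

Lemma measurable_bin k : measurable (bin k).
Proof.
rewrite bin_box; apply: (@measurable_box _ _ (fun i =>
  `](tnth k i)%:R / kappa%:R, (tnth k i).+1%:R / kappa%:R]%classic)) => i.
exact: measurable_itv.
Qed.

Lemma bin_sub_cube k : bin k `<=` cube.
Proof.
move=> x /binP h i; have /andP[h1 h2] := h i; rewrite in_itv /=; apply/andP; split.
  by rewrite -(pmulr_rge0 _ k0) (le_trans _ (ltW h1)).
rewrite -(ler_pM2l k0) mulr1 (le_trans h2) // ler_nat; exact: ltn_ord.
Qed.

Lemma trivIset_bin : trivIset setT bin.
Proof.
move=> k k' _ _ [x [/binP h /binP h']]; apply: eq_from_tnth => i; apply: val_inj => /=.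
have /andP[h1 h2] := h i; have /andP[h3 h4] := h' i.
apply/eqP; rewrite eqn_leq.
move: (lt_le_trans h1 h4) (lt_le_trans h3 h2).
by rewrite !ltr_nat !ltnS => -> ->.
Qed.

Lemma volume_bin (k : d.-tuple 'I_kappa) :
  mu (bin k) = ((kappa%:R ^+ d)^-1 : R)%:E.
Proof.
rewrite bin_box (@lebesgue_rV_box _ _ (fun i =>
  `](tnth k i)%:R / kappa%:R, (tnth k i).+1%:R / kappa%:R]%classic)) //.
rewrite (eq_bigr (fun=> (kappa%:R^-1)%:E)) => [|i _].
  by rewrite prodEFin prodr_const card_ord exprVn.
rewrite lebesgue_measure_itv /= lte_fin ltr_pM2r ?invr_gt0 // ltr_nat ltnSn.
by rewrite -EFinB -mulrBl -natrB // subSnn mul1r.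
Qed.

Lemma volume_unit_cube : mu cube = 1%E.
Proof.
rewrite [X in mu X](_ : _ = [set x : 'rV[R]_d | forall i, `[0, 1]%classic (x ord0 i)]) //.
rewrite (@lebesgue_rV_box _ _ (fun=> `[0, 1]%classic)) // big1 // => i _.
by rewrite lebesgue_measure_itv /= lte_fin ltr01 oppr0 adde0.
Qed.

Lemma negligible_cubeD_bins :
  mu (cube `\` \big[setU/set0]_k bin k) = 0%E.
Proof.
apply: negligible_setD_cells.
- exact: measurable_unit_cube.
- exact: measurable_bin.
- exact: bin_sub_cube.
- exact: trivIset_bin.
- rewrite [LHS]volume_unit_cube.
  rewrite (eq_bigr (fun=> ((kappa%:R ^+ d)^-1)%:E)) => [|k _]; last first.
    exact: volume_bin.
  rewrite sumEFin sumr_const card_tuple card_ord -[_ *+ (kappa ^ d)]mulr_natr natrX.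
  by rewrite mulVf // expf_neq0 // gt_eqF.
- by rewrite [X in (X < _)%E]volume_unit_cube ltry.
Qed.

Definition corner_box b (n : nat) : set 'rV[R]_d :=
  [set x | forall i, (b i)%:R < kappa%:R * x ord0 i <= (b i + n)%:R].

Definition in_corner b (n : nat) (k : d.-tuple 'I_kappa) : bool :=
  [forall i, (b i <= tnth k i < b i + n)%N].

Lemma measurable_corner_box b n : measurable (corner_box b n).
Proof.
rewrite [X in measurable X](_ : _ = [set x : 'rV[R]_d | forall i,
   `](b i)%:R / kappa%:R, (b i + n)%:R / kappa%:R]%classic (x ord0 i)]).
  apply: (@measurable_box _ _ (fun i =>
    `](b i)%:R / kappa%:R, (b i + n)%:R / kappa%:R]%classic)) => i.
  exact: measurable_itv.
apply/seteqP; split => x /= h i; have := h i;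
  by rewrite in_itv /= ltr_pdivrMr // ler_pdivlMr // mulrC.
Qed.

Lemma corner_box_sub_cube b n : (forall i, b i + n <= kappa)%N ->
  corner_box b n `<=` cube.
Proof.
move=> bn x h i; have /andP[h1 h2] := h i; rewrite in_itv /=; apply/andP; split.
  by rewrite -(pmulr_rge0 _ k0) (le_trans _ (ltW h1)).
by rewrite -(ler_pM2l k0) mulr1 (le_trans h2) // ler_nat.
Qed.

Lemma corner_boxI_bin b n k :
  corner_box b n `&` bin k = if in_corner b n k then bin k else set0.
Proof.
case: ifPn => [/forallP kb|]; last first.
  move=> /forallPn[i]; rewrite negb_and -ltnNge -leqNgt => kb.
  apply/seteqP; split => // x [/(_ i) /andP[h1 h2] /binP /(_ i) /andP[h3 h4]].
  case/orP : kb.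
    by rewrite -(ler_nat R) => h; have := lt_le_trans h1 (le_trans h4 h); rewrite ltxx.
  by rewrite -(ler_nat R) => h; have := lt_le_trans h3 (le_trans h2 h); rewrite ltxx.
apply/seteqP; split => [x []//|x kx]; split => // i.
move/binP : kx => /(_ i) /andP[h1 h2]; have /andP[k1 k2] := kb i.
rewrite (le_lt_trans _ h1) ?ler_nat //=.
by rewrite (le_trans h2) // ler_nat.
Qed.

Definition bin_prob f (k : d.-tuple 'I_kappa) : R := fine (law f (bin k)).

Section density.
Variables (f : 'rV[R]_d -> R) (fd : is_density f).

Let f_ge0 x : unit_cube x -> 0 <= f x. Proof. by case: fd => _ + _; exact. Qed.
Let mf : measurable_fun cube f. Proof. by case: fd. Qed.

Lemma law_ge0 A : (0 <= law f A)%E.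
Proof. by have [P ->] := law_probability fd; exact: measure_ge0. Qed.

Lemma law_bin k : law f (bin k) = (bin_prob f k)%:E.
Proof.
rewrite /bin_prob fineK // ge0_fin_numE ?law_ge0 //.
have [P ->] := law_probability fd.
by rewrite (le_lt_trans (probability_le1 _ _)) ?ltry //; exact: measurable_bin.
Qed.

Lemma bin_prob_ge0 k : 0 <= bin_prob f k.
Proof. by rewrite -lee_fin -law_bin law_ge0. Qed.

Lemma law_cells A : measurable A -> A `<=` cube ->
  (law f A = \sum_k law f (A `&` bin k))%E.
Proof.
move=> mA Ac; rewrite /law (setIidr Ac) (@ge0_integral_cells _ _ _ mu _ bin A (EFin \o f)) //.
- by apply: eq_bigr => k _; rewrite setIA (setIidr Ac).
- exact: measurable_bin.
- exact: trivIset_bin.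
- apply/eqP; rewrite eq_le measure_ge0 andbT -negligible_cubeD_bins.
  have mU : measurable (\big[setU/set0]_k bin k).
    by apply: bigsetU_measurable => k _; exact: measurable_bin.
  apply: le_measure; rewrite ?inE; [exact: measurableD| |exact: setSD].
  by apply: measurableD => //; exact: measurable_unit_cube.
- by apply/measurable_EFinP; apply: measurable_funS mf => //; exact: measurable_unit_cube.
- by move=> x /Ac cx; rewrite lee_fin f_ge0.
Qed.

Lemma bin_prob_sum1 : \sum_k bin_prob f k = 1.
Proof.
apply: EFin_inj; rewrite -sumEFin.
under eq_bigr => k _ do rewrite -law_bin -(setIidr (@bin_sub_cube k)).
rewrite -law_cells //; last exact: measurable_unit_cube.
by rewrite /law setIid; case: fd.
Qed.

Lemma bin_prob_le (M : R) k : (forall x, unit_cube x -> f x <= M) ->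
  bin_prob f k <= M / kappa%:R ^+ d.
Proof.
move=> fM; rewrite -lee_fin -law_bin /law (setIidr (@bin_sub_cube k)).
rewrite EFinM -(volume_bin k) -integral_cst; last exact: measurable_bin.
apply: ge0_le_integral => //.
- exact: measurable_bin.
- by move=> x /bin_sub_cube cx; rewrite lee_fin f_ge0.
- apply/measurable_EFinP; apply: measurable_funS mf; first exact: measurable_unit_cube.
  exact: bin_sub_cube.
- by move=> x /bin_sub_cube cx; rewrite lee_fin fM.
Qed.

Lemma law_corner_box b n : (forall i, b i + n <= kappa)%N ->
  law f (corner_box b n) = (\sum_(k | in_corner b n k) bin_prob f k)%:E.
Proof.
move=> bn; rewrite law_cells; [|exact: measurable_corner_box|exact: corner_box_sub_cube].
rewrite -sumEFin [RHS]big_mkcond /=; apply: eq_bigr => k _.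
rewrite corner_boxI_bin; case: ifP => _; first exact: law_bin.
by rewrite /law setI0 integral_set0.
Qed.

Definition half_open_cube : set 'rV[R]_d :=
  [set u | forall i, 0 < u ord0 i <= 1].

Definition vertex b : 'rV[R]_d := \row_i ((b i)%:R / kappa%:R).

Lemma preimage_corner_box b n : (0 < n)%N ->
  (fun u => vertex b + (n%:R / kappa%:R) *: u) @^-1` corner_box b n =
  half_open_cube.
Proof.
move=> n0; have n0' : 0 < n%:R :> R by rewrite ltr0n.
have E u i : kappa%:R * (vertex b + (n%:R / kappa%:R) *: u) ord0 i =
    (b i)%:R + n%:R * u ord0 i.
  by rewrite !mxE; field; exact: lt0r_neq0.
apply/seteqP; split => u /= h i; have := h i; rewrite E natrD ltrDl lerD2l.
  by rewrite pmulr_rgt0 // ger_pMr.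
by rewrite pmulr_rgt0 // ger_pMr.
Qed.

(** The dilation that maps the unit cube to a corner box turns an average of [f]
    along segments that start at a vertex into a sum of bin probabilities. *)
Lemma integral_dilated_density b n : (0 < n)%N -> (forall i, b i + n <= kappa)%N ->
  (\int[mu]_(u in half_open_cube) (f (vertex b + (n%:R / kappa%:R) *: u))%:E =
   ((kappa%:R / n%:R) ^+ d * \sum_(k | in_corner b n k) bin_prob f k)%:E)%E.
Proof.
move=> n0 bn; have n0' : 0 < n%:R :> R by rewrite ltr0n.
rewrite EFinM -(law_corner_box bn) /law (setIidr (corner_box_sub_cube bn)).
rewrite (@ge0_integral_rV_scale _ _ (vertex b) (n%:R / kappa%:R)
  (corner_box b n) (EFin \o f)); first last.
- by move=> x bx; rewrite lee_fin f_ge0 //; exact: (corner_box_sub_cube bn bx).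
- apply/measurable_EFinP; apply: measurable_funS mf; first exact: measurable_unit_cube.
  exact: corner_box_sub_cube.
- exact: measurable_corner_box.
- by rewrite divr_gt0.
rewrite preimage_corner_box // muleA -EFinM -exprMn.
rewrite (_ : kappa%:R / n%:R * (n%:R / kappa%:R) = 1) ?expr1n ?mul1e //.
by field; rewrite !gt_eqF.
Qed.

End density.

End bins.

(** * From bin probabilities to pointwise values *)

Section combination_of_averages.
Context {disp : measure_display} {T : measurableType disp} {R : realType}.
Variables (mu : {measure set T -> \bar R}) (D : set T).
Hypotheses (mD : measurable D) (mu1 : mu D = 1%E).

(** Averaging under a probability measure does not increase an interpolation
    error that is bounded pointwise. *)
Lemma le_norm_combination_of_averages n (w avg : 'I_n -> R) (c M eta : R)
    (g : 'I_n -> T -> R) :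
  (forall r, measurable_fun D (g r)) ->
  (forall r x, D x -> `|g r x| <= M) ->
  (forall r, \int[mu]_(x in D) (g r x)%:E = (avg r)%:E)%E ->
  0 <= eta -> (forall x, D x -> `|c - \sum_r w r * g r x| <= eta) ->
  `|c - \sum_r w r * avg r| <= eta.
Proof.
move=> mg gM gavg eta0 geta.
have ibnd (h : T -> R) (B : R) : measurable_fun D h ->
    (forall x, D x -> `|h x| <= B) -> mu.-integrable D (EFin \o h).
  move=> mh hB; apply: measurable_bounded_integrable => //.
    by rewrite mu1 ltry.
  exists B; split; first exact: num_real.
  by move=> B' BB' x Dx; exact: le_trans (hB _ Dx) (ltW BB').
have ig r : mu.-integrable D (EFin \o g r) by exact: ibnd (mg r) (gM r).
pose h x := c - \sum_r w r * g r x.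
have mS : measurable_fun D (fun x => \sum_r w r * g r x).
  by apply: measurable_sum => r; exact: measurable_funM.
have iS : mu.-integrable D (EFin \o (fun x => \sum_r w r * g r x)).
  apply: (ibnd _ (\sum_r `|w r| * M)) => // x Dx.
  rewrite (le_trans (ler_norm_sum _ _ _)) //; apply: ler_sum => r _.
  by rewrite normrM ler_wpM2l // gM.
have inth : (\int[mu]_(x in D) (h x)%:E = (c - \sum_r w r * avg r)%:E)%E.
  under eq_integral do rewrite EFinB.
  rewrite (integralB_EFin mD _ iS); last by apply: (ibnd (cst c) `|c|).
  rewrite EFinB; congr (_ - _)%E.
    by rewrite [LHS](integral_cst mu mD c%:E) mu1 mule1.
  under eq_integral do rewrite -sumEFin.
  rewrite integral_sum //; last first.
    move=> r; apply: (ibnd (fun x => w r * g r x) (`|w r| * M)).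
      exact: measurable_funM.
    by move=> x Dx; rewrite normrM ler_wpM2l // gM.
  rewrite -sumEFin; apply: eq_bigr => r _.
  under eq_integral do rewrite EFinM.
  by rewrite (integralZl mD (ig r)) EFinM -gavg.
have mh : measurable_fun D (EFin \o h).
  by apply/measurable_EFinP; exact: measurable_funB.
rewrite -lee_fin -[X in (X <= _)%E]/(`|(c - \sum_r w r * avg r)%:E|)%E -inth.
apply: (le_trans (le_abse_integral mu mD mh)).
rewrite -[leRHS]mule1 -mu1; apply: integral_le_bound => //.
by apply: aeW => x Dx /=; rewrite lee_fin geta.
Qed.

End combination_of_averages.

Section values_from_bin_probabilities.
Context {R : realType} {d : nat}.
Implicit Types (x y u : 'rV[R]_d) (f : 'rV[R]_d -> R) (b : 'I_d -> nat).

Local Notation mu := (@lebesgue_rV R d).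

Lemma integral_uniform (A : set 'rV[R]_d) : measurable A ->
  (\int[mu]_(x in A) (uniform_density x)%:E = mu A)%E.
Proof. by move=> mA; rewrite -[RHS]mul1e -integral_cst. Qed.

Lemma uniform_is_density : is_density (@uniform_density R d).
Proof.
split => [|x _|]; first exact: measurable_cst.
  exact: ler01.
by rewrite integral_uniform ?volume_unit_cube //; exact: measurable_unit_cube.
Qed.

Lemma measurable_half_open_cube : measurable (@half_open_cube R d).
Proof.
rewrite [X in measurable X](_ : _ = [set x : 'rV[R]_d | forall i,
   `]0, 1]%classic (x ord0 i)]); first exact: (@measurable_box _ _ (fun=> _)).
by apply/seteqP; split => x /= h i; have := h i; rewrite in_itv.
Qed.

Lemma volume_half_open_cube : mu half_open_cube = 1%E.
Proof.
rewrite [X in mu X](_ : _ = [set x : 'rV[R]_d | forall i,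
   `]0, 1]%classic (x ord0 i)]); last first.
  by apply/seteqP; split => x /= h i; have := h i; rewrite in_itv.
rewrite (@lebesgue_rV_box _ _ (fun=> `]0, 1]%classic)) // big1 // => i _.
by rewrite lebesgue_measure_itv /= lte_fin ltr01 oppr0 adde0.
Qed.

Variable kappa : nat.
Hypothesis kappa_gt0 : (0 < kappa)%N.
Let k0 : 0 < kappa%:R :> R. Proof. by rewrite ltr0n. Qed.

Local Notation deviation f k := `|bin_prob f k - (kappa%:R ^+ d)^-1|.

Lemma bin_prob_uniform (k : d.-tuple 'I_kappa) :
  bin_prob (@uniform_density R d) k = (kappa%:R ^+ d)^-1 :> R.
Proof.
rewrite /bin_prob /law (setIidr (@bin_sub_cube _ _ _ kappa_gt0 k)).
by rewrite integral_uniform ?volume_bin //; exact: measurable_bin.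
Qed.

Lemma dilated_corner_sub_cube b n u (t : R) : (forall i, b i + n <= kappa)%N ->
  half_open_cube u -> 0 <= t <= n%:R ->
  unit_cube (vertex kappa b + t *: (kappa%:R^-1 *: u)).
Proof.
move=> bn hu /andP[t0 tn] i; have /andP[u0 u1] := hu i.
rewrite in_itv /= !mxE.
have -> : (b i)%:R / kappa%:R + t * (kappa%:R^-1 * u ord0 i) =
   ((b i)%:R + t * u ord0 i) / kappa%:R by field; exact: lt0r_neq0.
rewrite divr_ge0 ?addr_ge0 ?mulr_ge0 ?(ltW u0) ?(ltW k0) //=.
rewrite ler_pdivrMr // mul1r; apply: (@le_trans _ _ (b i + n)%:R).
  rewrite natrD lerD2l (le_trans _ tn) //; by rewrite ler_piMr.
by rewrite ler_nat.
Qed.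

(** At a vertex [y] of the grid, interpolation at [0] from the nodes
    [1, ..., l + 1] along the segments [y + t u / kappa], averaged over [u] in
    the cube, replaces [f y] by a combination of the averages of [f] over the
    boxes of side [n / kappa] at the corner [y]. Each of these boxes is a union
    of bins. *)
Lemma holder_vertex (s L : R) f b : 0 < s -> 0 <= L ->
  is_density f -> holder s L f -> (1 <= d)%N ->
  let l := strict_floor s in
  let Lambda := l.+1%:R * l.+1%:R ^+ l in
  (forall i, b i + l.+1 <= kappa)%N ->
  `|f (vertex kappa b) - 1| <=
    (1 + Lambda) * (L * (l.+1%:R * (d%:R / kappa%:R)) `^ s) +
    Lambda * (kappa%:R ^+ d * \sum_(k : d.-tuple 'I_kappa | in_corner b l.+1 k) deviation f k).
Proof.
move=> s0 L0 fd Hf d1 l Lambda bl.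
have [w [wexact wle]] := @interpolation_weights R l l.+1 1 0.
have {}wle : \sum_r `|w r| <= Lambda by apply: wle; rewrite // lexx ler0n.
have w1 : \sum_r w r = 1.
  have := wexact 1; rewrite size_poly1 hornerC => /(_ isT) ->.
  by apply: eq_bigr => r _; rewrite hornerC mulr1.
pose y := vertex kappa b : 'rV[R]_d.
pose g (r : 'I_l.+1) u := f (y + ((1 + r)%:R / kappa%:R) *: u).
have br (r : 'I_l.+1) i : (b i + (1 + r) <= kappa)%N.
  by rewrite (leq_trans _ (bl i)) // leq_add2l ltn_ord.
pose Avg (r : 'I_l.+1) : R := (kappa%:R / (1 + r)%:R) ^+ d *
   \sum_(k : d.-tuple 'I_kappa | in_corner b (1 + r) k) bin_prob f k.
have intg r : (\int[mu]_(u in half_open_cube) (g r u)%:E = (Avg r)%:E)%E.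
  by rewrite (integral_dilated_density kappa_gt0 fd (n := 1 + r) isT (br r)).
(* the same identity for the uniform density, whose bins all have mass 1 / K *)
have avg1 (r : 'I_l.+1) : (kappa%:R / (1 + r)%:R) ^+ d *
   \sum_(k : d.-tuple 'I_kappa | in_corner b (1 + r) k) (kappa%:R ^+ d)^-1 = 1 :> R.
  have := integral_dilated_density kappa_gt0 uniform_is_density (n := 1 + r) isT (br r).
  rewrite [LHS]integral_uniform; last exact: measurable_half_open_cube.
  rewrite [LHS]volume_half_open_cube => -[] /esym.
  by under eq_bigr => k _ do rewrite bin_prob_uniform.
have cgu (r : 'I_l.+1) u : half_open_cube u ->
    unit_cube (y + ((1 + r)%:R / kappa%:R) *: u).
  move=> hu; rewrite -scalerA; apply: (dilated_corner_sub_cube bl hu).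
  by rewrite ler0n ler_nat ltn_ord.
have cy : unit_cube y.
  move=> i; rewrite in_itv /= mxE divr_ge0 //= ler_pdivrMr // mul1r ler_nat.
  exact: leq_trans (leq_addr _ _) (bl i).
pose eta := (1 + Lambda) * (L * (l.+1%:R * (d%:R / kappa%:R)) `^ s).
have eta_bound u : half_open_cube u -> `|f y - \sum_r w r * g r u| <= eta.
  move=> hu; pose v := kappa%:R^-1 *: u.
  have dv : enorm v <= d%:R / kappa%:R.
    rewrite mulrC enorm_le_dim ?invr_ge0 ?ltW // => i; rewrite mxE normrM.
    have /andP[u0 u1] := hu i.
    by rewrite !gtr0_norm ?invr_gt0 // ler_piMr ?invr_ge0 // ltW.
  have dk : 0 < d%:R / kappa%:R :> R by rewrite divr_gt0 ?ltr0n.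
  have nodeP (r : 'I_l.+1) : 0 <= ((1 + r)%:R : R) <= l.+1%:R.
    by rewrite ler0n ler_nat ltn_ord.
  have cT : unit_cube (y + l.+1%:R *: v).
    by apply: (dilated_corner_sub_cube bl hu); rewrite ler0n lexx.
  have t0 : 0 <= (0 : R) <= l.+1%:R by rewrite lexx ler0n.
  have := holder_interpolation s0 L0 Hf cy cT (ltr0Sn _ _) dk dv t0 nodeP wexact.
  rewrite scale0r addr0 => H.
  have -> : \sum_r w r * g r u = \sum_r w r * f (y + (1 + r)%:R *: v).
    by apply: eq_bigr => r _; rewrite /g /v scalerA.
  apply: (le_trans H); rewrite /eta ler_wpM2r ?lerD2l //.
  by rewrite mulr_ge0 // powR_ge0.
have fL x : unit_cube x -> `|f x| <= L by exact: holder_bounded Hf.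
have mg r : measurable_fun half_open_cube (g r).
  case: fd => mf _ _.
  apply: (measurable_comp (F := @unit_cube R d)) => //.
  - exact: measurable_unit_cube.
  - by move=> _ [u hu <-]; exact: cgu.
  - by apply: measurable_funTS; exact: measurable_affine.
have eta0 : 0 <= eta.
  rewrite /eta mulr_ge0 ?addr_ge0 ?mulr_ge0 ?powR_ge0 ?exprn_ge0 //.
have avg_bound : `|f y - \sum_r w r * Avg r| <= eta.
  apply: (@le_norm_combination_of_averages _ _ _ mu half_open_cube _ _ _ w Avg
    (f y) L eta g) => //.
  - exact: measurable_half_open_cube.
  - exact: volume_half_open_cube.
  - by move=> r u hu; apply: fL; exact: cgu.
have -> : f y - 1 = (f y - \sum_r w r * Avg r) + \sum_r w r * (Avg r - 1).
  rewrite [X in _ = _ + X](eq_bigr (fun r => w r * Avg r - w r)) => [|r _].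
    by rewrite sumrB w1 addrA subrK.
  by rewrite mulrBr mulr1.
rewrite (le_trans (ler_normD _ _)) // lerD //.
rewrite (le_trans (ler_norm_sum _ _ _)) //.
apply: (@le_trans _ _ (\sum_r `|w r| * (kappa%:R ^+ d *
    \sum_(k : d.-tuple 'I_kappa | in_corner b l.+1 k) deviation f k))); last first.
  rewrite -mulr_suml ler_wpM2r // mulr_ge0 ?exprn_ge0 //.
  exact: sumr_ge0.
apply: ler_sum => r _; rewrite normrM ler_wpM2l //.
rewrite /Avg -[X in _ - X](avg1 r) -mulrBr -sumrB normrM.
have r0 : 0 < (1 + r)%:R :> R by rewrite ltr0n.
have q0 : 0 <= kappa%:R / (1 + r)%:R :> R by rewrite divr_ge0.
rewrite (ger0_norm (exprn_ge0 _ q0)); apply: ler_pM => //.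
- rewrite lerXn2r ?nnegrE ?divr_ge0 ?(ltW k0) ?(ltW r0) //.
  by rewrite ler_pdivrMr // ler_peMr ?ler1n // ltW.
rewrite (le_trans (ler_norm_sum _ _ _)) //.
rewrite [leLHS]big_mkcond [leRHS]big_mkcond; apply: ler_sum => k _.
case: ifPn => [/forallP kr|_]; last by case: ifP.
rewrite ifT //; apply/forallP => i; have /andP[-> /=] := kr i.
by move=> /leq_trans; apply; rewrite leq_add2l ltn_ord.
Qed.

End values_from_bin_probabilities.

Section interpolation_from_vertices.
Context {R : realType} {d : nat}.
Implicit Types (x y : 'rV[R]_d) (f : 'rV[R]_d -> R).
Variables (kappa N : nat) (b : 'I_d -> nat).
Hypotheses (kappa_gt0 : (0 < kappa)%N) (bN : forall i, (b i + N <= kappa)%N).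
Let k0 : 0 < kappa%:R :> R. Proof. by rewrite ltr0n. Qed.

Let block x := forall i, (b i)%:R <= kappa%:R * x ord0 i <= (b i + N)%:R.

Let block_sub_cube x : block x -> unit_cube x.
Proof.
move=> bx i; have /andP[h1 h2] := bx i; rewrite in_itv /=; apply/andP; split.
  by rewrite -(pmulr_rge0 _ k0) (le_trans _ h1).
by rewrite -(ler_pM2l k0) mulr1 (le_trans h2) // ler_nat.
Qed.

(** Lagrange interpolation is applied to one coordinate at a time, and each
    coordinate costs a factor [Lambda] and one interpolation error. *)
Lemma holder_from_vertices (s L V : R) f :
  let l := strict_floor s in
  let Lambda := l.+1%:R * N%:R ^+ l in
  0 < s -> 0 <= L -> holder s L f -> (l < N)%N ->
  (forall r : 'I_d -> nat, (forall i, r i <= l)%N ->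
     `|f (vertex kappa (fun i => b i + r i)%N) - 1| <= V) ->
  forall x, (forall i, (b i)%:R <= kappa%:R * x ord0 i <= (b i + N)%:R) ->
  `|f x - 1| <= Lambda ^+ d *
     (V + d%:R * ((1 + Lambda) * (L * (N%:R * kappa%:R^-1) `^ s))).
Proof.
move=> l Lambda s0 L0 Hf lN HV.
set eta := (1 + Lambda) * _.
have V0 : 0 <= V by apply: le_trans (HV (fun=> 0%N) _).
have N1 : (1:R) <= N%:R by rewrite ler1n (leq_trans _ lN).
have Lambda1 : 1 <= Lambda.
  by rewrite /Lambda mulr_ege1 ?ler1n // exprn_ege1.
have Lambda0 : 0 <= Lambda by apply: le_trans Lambda1.
have eta0 : 0 <= eta by rewrite !mulr_ge0 ?powR_ge0 // addr_ge0.
(* after j steps the first j coordinates are free, the others on the grid *)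
suff claim j : (j <= d)%N -> forall x, block x ->
    (forall i : 'I_d, (j <= i)%N ->
       exists2 r : nat, (r <= l)%N & kappa%:R * x ord0 i = (b i + r)%:R) ->
    `|f x - 1| <= Lambda ^+ j * (V + j%:R * eta).
  move=> x bx; apply: claim => // i di.
  by have := ltn_ord i; rewrite ltnNge di.
elim: j => [_ x bx xr|j IHj jd x bx xr].
  rewrite expr0 mul1r mul0r addr0.
  have /choice[r rP] : forall i, exists r : nat,
      (r <= l)%N /\ kappa%:R * x ord0 i = (b i + r)%:R.
    by move=> i; have [r] := xr i isT; exists r.
  have -> : x = vertex kappa (fun i => b i + r i)%N.
    apply/rowP => i; rewrite mxE; have [_ <-] := rP i.
    by field; exact: lt0r_neq0.
  by apply: HV => i; have [] := rP i.
pose i0 := Ordinal jd.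
pose t := kappa%:R * x ord0 i0 - (b i0)%:R.
pose v : 'rV[R]_d := kappa%:R^-1 *: delta_mx ord0 i0.
pose x0 : 'rV[R]_d := \row_i if i == i0 then (b i0)%:R / kappa%:R else x ord0 i.
have xE u i : kappa%:R * (x0 + u *: v) ord0 i =
    if i == i0 then (b i0)%:R + u else kappa%:R * x ord0 i.
  rewrite !mxE eqxx /=; case: eqP => _; rewrite ?mulr1n ?mulr0n; field;
    exact: lt0r_neq0.
have x0E : x = x0 + t *: v.
  apply/rowP => i; apply: (mulfI (lt0r_neq0 k0)); rewrite xE.
  by case: eqP => [->|//]; rewrite /t addrC subrK.
have block_line u : 0 <= u <= N%:R -> block (x0 + u *: v).
  move=> /andP[u0 uN] i; rewrite xE; case: eqP => [->|_]; last exact: bx.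
  by rewrite natrD lerD2l uN lerDl u0.
have tN : 0 <= t <= N%:R.
  by have /andP[h1 h2] := bx i0; rewrite /t subr_ge0 h1 lerBlDl -natrD.
have [w [wexact wle]] := @interpolation_weights R l N 0 t.
have {}wle := wle (ltnW lN) tN.
have w1 : \sum_r w r = 1.
  have := wexact 1; rewrite size_poly1 hornerC => /(_ isT) ->.
  by apply: eq_bigr => r _; rewrite hornerC mulr1.
have nodeP (r : 'I_l.+1) : 0 <= ((0 + r)%:R : R) <= N%:R.
  by rewrite ler0n ler_nat (leq_trans _ lN) // ltnW // ltn_ord.
have cx : unit_cube x0.
  by rewrite -[x0]addr0 -(scale0r v); apply/block_sub_cube/block_line; rewrite lexx ler0n.
have cT : unit_cube (x0 + N%:R *: v).
  by apply/block_sub_cube/block_line; rewrite lexx ler0n.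
have ev : enorm v <= kappa%:R^-1.
  by rewrite /v enormZ enorm_delta mulr1 gtr0_norm ?invr_gt0.
have ik0 : 0 < kappa%:R^-1 :> R by rewrite invr_gt0.
have N0 : 0 < N%:R :> R by apply: lt_le_trans N1.
have := holder_interpolation s0 L0 Hf cx cT N0 ik0 ev tN nodeP wexact.
rewrite -x0E => Hint.
have -> : f x - 1 = (f x - \sum_r w r * f (x0 + (0 + r)%:R *: v)) +
    \sum_r w r * (f (x0 + (0 + r)%:R *: v) - 1).
  rewrite [X in _ = _ + X](eq_bigr (fun r =>
    w r * f (x0 + (0 + r)%:R *: v) - w r)) => [|r _].
    by rewrite sumrB w1 addrA subrK.
  by rewrite mulrBr mulr1.
have W0 : 0 <= Lambda ^+ j * (V + j%:R * eta).
  by rewrite mulr_ge0 ?exprn_ge0 // addr_ge0 // mulr_ge0.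
have part1 : `|f x - \sum_r w r * f (x0 + (0 + r)%:R *: v)| <= eta.
  apply: (le_trans Hint); rewrite /eta ler_wpM2r ?lerD2l //.
  by rewrite mulr_ge0 // powR_ge0.
have part2 : `|\sum_r w r * (f (x0 + (0 + r)%:R *: v) - 1)| <=
    Lambda * (Lambda ^+ j * (V + j%:R * eta)).
  apply: (@le_trans _ _ (\sum_r `|w r| * (Lambda ^+ j * (V + j%:R * eta)))).
    rewrite (le_trans (ler_norm_sum _ _ _)) //; apply: ler_sum => r _.
    rewrite normrM ler_wpM2l //; apply: IHj; [exact: ltnW|exact: block_line|].
    move=> i ji; rewrite xE; case: eqP => [->|ii0].
      exists (r : nat); first by rewrite -ltnS ltn_ord.
      by rewrite add0n natrD.
    apply: xr; rewrite ltn_neqAle ji andbT; apply/eqP => ij.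
    by apply: ii0; apply: val_inj.
  by rewrite -mulr_suml ler_wpM2r.
rewrite (le_trans (ler_normD _ _)) // (le_trans (lerD part1 part2)) //.
have -> : Lambda ^+ j.+1 * (V + j.+1%:R * eta) =
    Lambda ^+ j.+1 * eta + Lambda * (Lambda ^+ j * (V + j%:R * eta)).
  by rewrite exprS -addn1 natrD; ring.
by rewrite lerD2r ler_peMl // exprn_ege1.
Qed.

End interpolation_from_vertices.

Section quadratic_approximation.
Context {R : realType} {d : nat}.
Implicit Types (x : 'rV[R]_d) (f : 'rV[R]_d -> R).
Local Notation mu := (@lebesgue_rV R d).

Lemma sqr_sum_le_card (I : finType) (P : pred I) (u : I -> R) :
  (\sum_(i | P i) u i) ^+ 2 <= #|P|%:R * \sum_(i | P i) u i ^+ 2.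
Proof.
rewrite expr2 mulr_suml.
have -> : #|P|%:R * \sum_(i | P i) u i ^+ 2 =
    \sum_(i | P i) \sum_(j | P j) (u i ^+ 2 + u j ^+ 2) / 2.
  under [RHS]eq_bigr => i _ do rewrite -mulr_suml big_split sumr_const /=.
  rewrite -mulr_suml big_split /= sumr_const sumrMnl -mulr2n.
  by rewrite mulr_natl -[X in X / 2]mulr_natr mulfK.
apply: ler_sum => i _; rewrite mulr_sumr; apply: ler_sum => j _.
by have := sqr_ge0 (u i - u j); nra.
Qed.

Definition neighbours kappa (N : nat) (k k' : d.-tuple 'I_kappa) : bool :=
  [forall i, (tnth k i < tnth k' i + N) && (tnth k' i < tnth k i + N)]%N.

Lemma neighboursC kappa N (k k' : d.-tuple 'I_kappa) :
  neighbours N k k' = neighbours N k' k.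
Proof. by apply: eq_forallb => i; rewrite andbC. Qed.

Lemma card_neighbours kappa N (k : d.-tuple 'I_kappa) : (0 < N)%N ->
  (#|neighbours N k| <= N.*2 ^ d)%N.
Proof.
move=> N0; have N20 : (0 < N.*2)%N by rewrite double_gt0.
pose phi (k' : d.-tuple 'I_kappa) : {ffun 'I_d -> 'I_(N.*2)} :=
  [ffun i => Ordinal (ltn_pmod (tnth k' i + N - tnth k i) N20)].
rewrite -(@card_in_imset _ _ phi); last first.
  move=> k1 k2 /forallP h1 /forallP h2 /ffunP e; apply: eq_from_tnth => i.
  have := e i; rewrite !ffunE => /(congr1 val) /=.
  have /andP[a1 b1] := h1 i; have /andP[a2 b2] := h2 i.
  rewrite !modn_small; [move=> E; apply: val_inj => /=; lia|lia|lia].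
by rewrite (leq_trans (max_card _)) // card_ffun !card_ord.
Qed.

(** The [2 (l + 1)] bins per direction leave room for the [l + 1] vertices from
    which [f x] is interpolated, and for a box of side [(l + 1) / kappa] at each
    of them. *)
Lemma holder_pointwise (s L : R) f (kappa : nat) :
  let l := strict_floor s in
  let N := l.+1.*2 in
  let Lambda := l.+1%:R * N%:R ^+ l in
  let C0 := (1 + Lambda) * L * ((l.+1%:R * d%:R) `^ s + d%:R * N%:R `^ s) in
  0 < s -> 0 <= L -> (1 <= d)%N -> (N <= kappa)%N ->
  is_density f -> holder s L f ->
  forall (k : d.-tuple 'I_kappa) x, bin k x ->
  `|f x - 1| <= Lambda ^+ d * C0 * kappa%:R^-1 `^ s +
    Lambda ^+ d.+1 * (kappa%:R ^+ d *
      \sum_(k' | neighbours N k k') `|bin_prob f k' - (kappa%:R ^+ d)^-1|).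
Proof.
move=> l N Lambda C0 s0 L0 d1 Nk fd Hf k x kx.
have lN : (l < N)%N by rewrite /N -addnn leq_addr.
have k0 : (0 < kappa)%N by rewrite (leq_trans _ Nk).
have kR0 : 0 < kappa%:R :> R by rewrite ltr0n.
(* near the upper faces of the cube the block of bins is moved inwards *)
pose b (i : 'I_d) := minn (tnth k i) (kappa - N).
have bN i : (b i + N <= kappa)%N by rewrite /b; lia.
have bk i : (b i <= tnth k i < b i + N)%N.
  by have := ltn_ord (tnth k i); rewrite /b; lia.
have Lambda1 : 1 <= Lambda.
  by rewrite /Lambda mulr_ege1 ?ler1n // exprn_ege1 // ler1n.
have Lambda0 : 0 <= Lambda by apply: le_trans Lambda1.
pose Lambda' : R := l.+1%:R * l.+1%:R ^+ l.
have Lambda'0 : 0 <= Lambda' by rewrite mulr_ge0 ?exprn_ge0.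
have LL : Lambda' <= Lambda.
  by rewrite ler_wpM2l // lerXn2r ?nnegrE // ler_nat.
set S := \sum_(k' | _) _; set q := _ `^ s.
have S0 : 0 <= S by exact: sumr_ge0.
have q0 : 0 <= q by exact: powR_ge0.
pose V := (1 + Lambda) * (L * ((l.+1%:R * d%:R) `^ s * q)) +
  Lambda * (kappa%:R ^+ d * S).
have HV r : (forall i, r i <= l)%N ->
    `|f (vertex kappa (fun i => b i + r i)%N) - 1| <= V.
  move=> rl.
  have brl i : (b i + r i + l.+1 <= kappa)%N.
    by have := bN i; have := rl i; rewrite /N; lia.
  apply: (le_trans (holder_vertex k0 s0 L0 fd Hf d1 brl)).
  rewrite -/l -/Lambda' (mulrA l.+1%:R) powRM ?invr_ge0 ?mulr_ge0 // -/q lerD //.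
    by rewrite ler_wpM2r ?lerD2l // mulr_ge0 // mulr_ge0 // powR_ge0.
  apply: ler_pM => //; first by rewrite mulr_ge0 ?exprn_ge0 // sumr_ge0.
  rewrite ler_wpM2l ?exprn_ge0 // /S [leLHS]big_mkcond [leRHS]big_mkcond.
  apply: ler_sum => k' _; case: ifPn => [/forallP kb|_]; last by case: ifP.
  rewrite ifT //; apply/forallP => i.
  by have := kb i; have := bk i; have := rl i; rewrite /N; lia.
have xb i : (b i)%:R <= kappa%:R * x ord0 i <= (b i + N)%:R.
  move/(binP k0) : kx => /(_ i) /andP[h1 h2]; have /andP[b1 b2] := bk i.
  by rewrite (le_trans _ (ltW h1)) ?ler_nat //= (le_trans h2) // ler_nat.
have := holder_from_vertices k0 bN s0 L0 Hf lN HV xb.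
rewrite -/l -/Lambda powRM ?invr_ge0 // -/q => /le_trans; apply.
rewrite /V /C0 exprS le_eqVlt; apply/orP; left; apply/eqP; ring.
Qed.

(** The approximation error is of order [kappa ^ (- s)] for every [s], although
    projecting on the functions that are constant on bins only achieves
    [kappa ^ (- 1)]. *)
Lemma L2_le_power_gap (s L : R) : 0 < s -> 0 <= L -> (1 <= d)%N ->
  exists A C : R, [/\ 0 < A, 0 < C & forall f kappa,
    ((strict_floor s).+1.*2 <= kappa)%N -> is_density f -> holder s L f ->
    (\int[mu]_(x in @unit_cube R d) ((f x - 1) ^+ 2)%:E <=
     (A * (kappa%:R ^+ d * power_gap (@bin_prob R d kappa f)) +
      C * (kappa%:R^-1 `^ s) ^+ 2)%:E)%E].
Proof.
move=> s0 L0 d1; set l := strict_floor s; pose N := l.+1.*2.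
pose Lambda : R := l.+1%:R * N%:R ^+ l.
pose C0 := (1 + Lambda) * L * ((l.+1%:R * d%:R) `^ s + d%:R * N%:R `^ s).
pose C1 := Lambda ^+ d * C0; pose C2 := Lambda ^+ d.+1.
pose D : R := (N.*2 ^ d)%:R.
exists (2 * C2 ^+ 2 * D ^+ 2 + 1), (2 * C1 ^+ 2 + 1).
have A0 (z y : R) : 0 <= 2 * z ^+ 2 * y ^+ 2 
  by apply: mulr_ge0; [apply: mulr_ge0|]; rewrite ?sqr_ge0.
split=> [||f kappa Nk fd Hf]; first by apply: ltr_wpDl; rewrite ?A0 // ltr01.
  by apply: ltr_wpDl; [apply: mulr_ge0|]; rewrite ?sqr_ge0 // ltr01.
have k0 : (0 < kappa)%N by rewrite (leq_trans _ Nk).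
have kR0 : 0 < kappa%:R :> R by rewrite ltr0n.
set K := kappa%:R ^+ d : R; have K0 : 0 < K by rewrite exprn_gt0.
set q := _ `^ s; set gap := power_gap _.
pose delta (k : d.-tuple 'I_kappa) := bin_prob f k - K^-1.
have gapE : gap = \sum_k delta k ^+ 2.
  by rewrite /gap /power_gap card_tuple card_ord natrX.
have gap0 : 0 <= gap by rewrite gapE sumr_ge0 // => k _; exact: sqr_ge0.
pose G k := 2 * C1 ^+ 2 * q ^+ 2 +
  2 * C2 ^+ 2 * K ^+ 2 * (D * \sum_(k' | neighbours N k k') delta k' ^+ 2).
have fG k x : bin k x -> (f x - 1) ^+ 2 <= G k.
  move=> kx; have := holder_pointwise s0 L0 d1 Nk fd Hf kx.
  rewrite -/l -/N -/Lambda -/C0 -/C1 -/C2 -/K -/q.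
  set S := \sum_(k' | _) _ => H.
  have S0 : 0 <= S by exact: sumr_ge0.
  have H2 : (f x - 1) ^+ 2 <= (C1 * q + C2 * (K * S)) ^+ 2.
    rewrite -real_normK ?num_real // lerXn2r ?nnegrE //.
    exact: le_trans H.
  apply: (le_trans H2).
  have HS : S ^+ 2 <= D * \sum_(k' | neighbours N k k') delta k' ^+ 2.
    apply: (le_trans (sqr_sum_le_card _ _)).
    under eq_bigr => k' _ do rewrite real_normK ?num_real //.
    rewrite ler_wpM2r ?sumr_ge0 // => [k' _|]; first exact: sqr_ge0.
    by rewrite /D ler_nat card_neighbours.
  have : 2 * C2 ^+ 2 * K ^+ 2 * S ^+ 2 <= 2 * C2 ^+ 2 * K ^+ 2 *
      (D * \sum_(k' | neighbours N k k') delta k' ^+ 2).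
    by rewrite ler_wpM2l.
  rewrite /G; have := sqr_ge0 (C1 * q - C2 * (K * S)); nra.
have mf := @measurable_unit_cube R d.
have mff : measurable_fun (@unit_cube R d) (fun x => ((f x - 1) ^+ 2)%:E).
  case: fd => mf' _ _; apply/measurable_EFinP; apply: measurable_funX.
  exact: measurable_funB.
rewrite (@ge0_integral_cells _ _ _ mu _ (@bin R d kappa)) //; first last.
- by move=> x _; rewrite lee_fin sqr_ge0.
- exact: negligible_cubeD_bins.
- exact: trivIset_bin.
- exact: measurable_bin.
apply: (@le_trans _ _ (\sum_k (G k * K^-1)%:E)%E).
  apply: lee_sum => k _; rewrite (setIidr (@bin_sub_cube _ _ _ k0 k)).
  rewrite EFinM -(volume_bin k0 k) -integral_cst; last exact: measurable_bin.
  apply: ge0_le_integral => //.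
  - exact: measurable_bin.
  - by move=> x _; rewrite lee_fin sqr_ge0.
  - by apply: measurable_funS mff => //; exact: bin_sub_cube.
  - by move=> x kx; rewrite lee_fin fG.
rewrite sumEFin lee_fin -mulr_suml ler_pdivrMr //.
rewrite /G big_split /= sumr_const card_tuple card_ord -[X in X + _]mulr_natl natrX -/K.
rewrite -!mulr_sumr.
have Hsum : \sum_k \sum_(k' | neighbours N k k') delta k' ^+ 2 <= D * gap.
  rewrite (exchange_big_dep xpredT) //= gapE mulr_sumr; apply: ler_sum => k' _.
  under eq_bigl => k do rewrite neighboursC.
  rewrite sumr_const -[leLHS]mulr_natl ler_wpM2r ?sqr_ge0 //.
  by rewrite /D ler_nat card_neighbours.
have : 2 * C2 ^+ 2 * K ^+ 2 * (D *
    \sum_k \sum_(k' | neighbours N k k') delta k' ^+ 2) <=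
    2 * C2 ^+ 2 * K ^+ 2 * (D * (D * gap)).
  by rewrite ler_wpM2l // ler_wpM2l // /D.
move=> /(lerD (lexx (K * (2 * C1 ^+ 2 * q ^+ 2)))) /le_trans; apply.
rewrite -subr_ge0.
have -> : ((2 * C2 ^+ 2 * D ^+ 2 + 1) * (K * gap) + (2 * C1 ^+ 2 + 1) * q ^+ 2) * K -
  (K * (2 * C1 ^+ 2 * q ^+ 2) + 2 * C2 ^+ 2 * K ^+ 2 * (D * (D * gap))) =
  K ^+ 2 * gap + K * q ^+ 2 by ring.
by rewrite addr_ge0 // mulr_ge0 ?sqr_ge0 // ltW.
Qed.

End quadratic_approximation.

(** * Errors of the chi-squared test *)

Section expectation_over_cells.
Context {R : realType} {d : nat}.
Implicit Types (f : 'rV[R]_d -> R).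
Variables (kappa m : nat).
Hypothesis kappa_gt0 : (0 < kappa)%N.
Local Notation cell := (d.-tuple 'I_kappa).
Local Notation sample := (m.-tuple 'rV[R]_d).

Definition cell_box (c : {ffun 'I_m -> cell}) : set sample :=
  [set X | forall i, bin (c i) (tnth X i)].

Lemma measurable_cell_box c : measurable (cell_box c).
Proof.
rewrite [X in measurable X](_ : _ = \bigcap_(i in [set: 'I_m])
    (fun X : sample => tnth X i) @^-1` bin (c i)).
  apply: fin_bigcap_measurable => // i _; rewrite -[X in measurable X]setTI.
  by apply: measurable_tnth => //; exact: measurable_bin.
by apply/seteqP; split => X /= h i; [move=> _|]; exact: h.
Qed.

Lemma trivIset_cell_box : trivIset setT cell_box.
Proof.
move=> c c' _ _ [X [h h']]; apply/ffunP => i.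
by apply: (trivIset_bin kappa_gt0 I I); exists (tnth X i).
Qed.

(** Up to a null set, the sample space is the disjoint union of the sets where
    every observation lies in a prescribed bin. *)
Lemma expect_cells f (phi : sample -> R) (Phi : {ffun 'I_m -> cell} -> R) :
  is_density f -> measurable_fun setT phi -> (forall X, 0 <= phi X) ->
  (forall c X, cell_box c X -> phi X = Phi c) ->
  expect f phi = (mean (@bin_prob R d kappa f) Phi)%:E.
Proof.
move=> fd mphi phi0 phiE; have [P PE] := law_probability fd.
rewrite /expect PE; set Q := tuple_measure P m.
have QT : Q setT = 1%E.
  transitivity (\prod_(i < m) P setT)%E; last first.
    by rewrite big1 // => i _; exact: probability_setT.
  rewrite -tuple_measure_box //; congr (tuple_measure _ _ _).
  by apply/seteqP; split.
have Qc c : Q (cell_box c) = (weight (@bin_prob R d kappa f) c)%:E.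
  rewrite /Q /cell_box (@tuple_measure_box _ _ _ _ m (fun i => bin (c i))); last first.
    by move=> i; exact: measurable_bin.
  by rewrite /weight -prodEFin; apply: eq_bigr => i _;
    have := law_bin fd (c i); rewrite PE.
have Q0 : Q (setT `\` \big[setU/set0]_c cell_box c) = 0%E.
  apply: negligible_setD_cells => //.
  - exact: measurable_cell_box.
  - exact: trivIset_cell_box.
  - rewrite [LHS]QT (eq_bigr _ (fun c _ => Qc c)) sumEFin weight_sum1 //.
    exact: bin_prob_sum1.
  - by rewrite [X in (X < _)%E]QT ltry.
rewrite (@ge0_integral_cells _ _ _ _ _ cell_box setT (EFin \o phi)) //; first last.
- by move=> X _; rewrite lee_fin.
- exact/measurable_EFinP.
- exact: trivIset_cell_box.
- exact: measurable_cell_box.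
rewrite /mean -sumEFin; apply: eq_bigr => c _.
rewrite setTI EFinM -[X in (X * _)%E]Qc muleC -integral_cst; last exact: measurable_cell_box.
by apply: eq_integral => X; rewrite inE => cX /=; rewrite (phiE c).
Qed.

Lemma chi2_stat_cells c (X : sample) : cell_box c X ->
  chi2_stat kappa X = cell_chi2 R c.
Proof.
move=> cX; rewrite /chi2_stat /cell_chi2 card_tuple card_ord natrX.
apply: eq_bigr => k _; congr ((_ - _) ^+ 2).
rewrite /bin_count -sum1_card natr_sum big_mkcond /=; apply: eq_bigr => i _.
rewrite inE; case: eqP => [<-|ck]; first by rewrite ifT ?mulr1n //; exact: cX.
case: ifPn => // kX; case: ck.
by apply: (trivIset_bin kappa_gt0 I I); exists (tnth X i); split; [exact: cX|].
Qed.

(** Chebyshev's inequality for the statistic, on either side of its mean. *)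
Lemma chi2_test_errors f (M tau t : R) (p := @bin_prob R d kappa f)
  (bound := (8 * m%:R ^+ 3 * (M / kappa%:R ^+ d) * power_gap p +
             4 * m%:R ^+ 2 * (M / kappa%:R ^+ d)) / t ^+ 2) :
  is_density f -> 0 <= M -> (forall x, unit_cube x -> f x <= M) -> 0 < t ->
  (cell_chi2_mean p m + t <= tau ->
     (expect f (@chi2_test R d m kappa tau) <= bound%:E)%E) /\
  (tau + t <= cell_chi2_mean p m ->
     (expect f (fun X => 1 - @chi2_test R d m kappa tau X)%R <= bound%:E)%E).
Proof.
move=> fd M0 fM t0.
have p0 k : 0 <= p k by exact: bin_prob_ge0.
have p1 : \sum_k p k = 1 by exact: bin_prob_sum1.
have pM k : p k <= M / #|{: cell}|%:R.
  by rewrite card_tuple card_ord natrX; exact: bin_prob_le.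
have var := cell_chi2_variance_le m p0 p1 M0 pM.
have {}var : mean p (fun c : {ffun 'I_m -> cell} =>
    (cell_chi2 R c - cell_chi2_mean p m) ^+ 2) / t ^+ 2 <= bound.
  rewrite ler_pM2r ?invr_gt0 ?exprn_gt0 //; apply: (le_trans var).
  by rewrite card_tuple card_ord natrX.
have mtest := @measurable_chi2_test R d m kappa tau.
split => gap.
  rewrite (@expect_cells _ _ (fun c => (tau < cell_chi2 R c)%R%:R)) //.
  - rewrite lee_fin; apply: le_trans var.
    apply: (markov_sqr p0 t0) => c h; rewrite ler_normr; apply/orP; left.
    lra.
  - by move=> c X cX; rewrite /chi2_test (chi2_stat_cells cX).
rewrite (@expect_cells _ _ (fun c => (~~ (tau < cell_chi2 R c)%R)%:R)) //.
- rewrite lee_fin; apply: le_trans var.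
  apply: (markov_sqr p0 t0) => c; rewrite -leNgt => h.
  by rewrite ler_normr; apply/orP; right; lra.
- exact: measurable_funB.
- by move=> X; rewrite /chi2_test subr_ge0; case: (_ < _).
- move=> c X cX; rewrite /chi2_test (chi2_stat_cells cX).
  by case: ltP => _; rewrite ?subrr ?subr0.
Qed.

End expectation_over_cells.

(** * Choice of the number of bins *)

Section final_estimates.
Context {R : realType}.

(** The next two lemmas are about [S = sqrt K] and a signal [m ^ 2 * gap] of at
    least [32 a ^ 2 m / S]: a quarter of the signal separates the mean of the
    statistic from the threshold, and is large with respect to the standard
    deviation. *)
Lemma type_two_margin (m S gap a : R) : 2 <= m -> 1 <= S -> 1 <= a ->
  32 * a ^+ 2 * m / S <= m ^+ 2 * gap ->
  m + a * m / S + m ^+ 2 * gap / 4 <= m - m / S ^+ 2 + m * (m - 1) * gap.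
Proof.
move=> m2 S1 a1 gapP.
have S0 : 0 < S by lra.
set rho := m / S; have rho0 : 0 < rho by rewrite divr_gt0 //; lra.
have rE : m / S ^+ 2 <= rho.
  rewrite /rho ler_pdivrMr ?exprn_gt0 // (_ : m / S * S ^+ 2 = m * S).
    by rewrite ler_peMr //; lra.
  by field; exact: lt0r_neq0.
have gP : 32 * a ^+ 2 * rho <= m ^+ 2 * gap by rewrite mulrA.
have gap0 : 0 <= gap.
  have : 0 <= m ^+ 2 * gap.
    apply: (le_trans _ gP); apply: mulr_ge0; last exact: ltW.
    by apply: mulr_ge0; rewrite ?sqr_ge0.
  by rewrite pmulr_rge0 // exprn_gt0 //; lra.
have aE : a * m / S = a * rho by rewrite /rho mulrA.
have aa : rho <= a * rho by rewrite ler_peMl // ltW.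
have aaa : a * rho <= a ^+ 2 * rho by rewrite expr2 -mulrA ler_peMl // mulr_ge0 ?ltW //; lra.
have mm : m ^+ 2 * gap / 2 <= m * (m - 1) * gap by nra.
lra.
Qed.

Lemma type_two_bound (m S gap a L : R) : 2 <= m -> 1 <= S -> 1 <= a -> 0 <= L ->
  32 * a ^+ 2 * m / S <= m ^+ 2 * gap ->
  (8 * m ^+ 3 * (L / S ^+ 2) * gap + 4 * m ^+ 2 * (L / S ^+ 2)) /
    (m ^+ 2 * gap / 4) ^+ 2 <= 5 * L / a ^+ 2.
Proof.
move=> m2 S1 a1 L0; set D := m ^+ 2 * gap.
have S0 : 0 < S by lra.
have a0 : 0 < a ^+ 2 by rewrite exprn_gt0 //; lra.
set rho := m / S; have rho0 : 0 < rho by rewrite divr_gt0 //; lra.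
have -> : 32 * a ^+ 2 * m / S = 32 * (a ^+ 2 * rho) by rewrite /rho !mulrA.
move=> DP.
have D0 : 0 < D by apply: (lt_le_trans _ DP); rewrite mulr_gt0 // mulr_gt0.
have -> : 8 * m ^+ 3 * (L / S ^+ 2) * gap + 4 * m ^+ 2 * (L / S ^+ 2) =
    L * (8 * (m / S ^+ 2) * D + 4 * rho ^+ 2).
  by rewrite /D /rho; field; exact: lt0r_neq0.
have rE : m / S ^+ 2 <= rho.
  rewrite /rho ler_pdivrMr ?exprn_gt0 // (_ : m / S * S ^+ 2 = m * S).
    by rewrite ler_peMr //; lra.
  by field; exact: lt0r_neq0.
rewrite ler_pdivrMr ?exprn_gt0 ?divr_gt0 //.
have -> : 5 * L / a ^+ 2 * (D / 4) ^+ 2 = L * (5 / 16 * (D ^+ 2 / a ^+ 2)).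
  by field; apply: lt0r_neq0; lra.
rewrite ler_wpM2l //.
pose y := D / a ^+ 2; have y0 : 0 < y by rewrite divr_gt0.
have -> : D ^+ 2 / a ^+ 2 = y * D by rewrite /y expr2 mulrAC.
have ry : rho <= y / 32 by rewrite /y !ler_pdivlMr //; lra.
have aa : rho <= a ^+ 2 * rho by rewrite ler_peMl ?(ltW rho0) // exprn_ege1.
have rD : rho <= D / 32 by lra.
have t1 : m / S ^+ 2 * D <= y / 32 * D.
  by rewrite ler_pM2r // (le_trans rE).
have t2 : rho ^+ 2 <= y / 32 * (D / 32).
  by rewrite expr2 ler_pM // ltW.
have yD : 0 < y * D by rewrite mulr_gt0.
lra.
Qed.

Lemma sup0_le (A : set (\bar R)) (b : \bar R) : (0 <= b)%E ->
  (forall x, A x -> x <= b)%E -> (Defs.sup0 A <= b)%E.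
Proof.
by move=> b0 Ab; rewrite /Defs.sup0; case: (A == set0) => //; exact: ge_ereal_sup.
Qed.

Lemma L2dist_le_sqr {d : nat} (f g : 'rV[R]_d -> R) (eps B : R) : 0 <= eps ->
  (eps%:E <= L2dist f g)%E ->
  (\int[@lebesgue_rV R d]_(x in @unit_cube R d) ((f x - g x) ^+ 2)%:E <= B%:E)%E ->
  eps ^+ 2 <= B.
Proof.
move=> eps0; rewrite /L2dist; set I := (\int[_]_(x in _) _)%E.
have I0 : (0 <= I)%E by apply: integral_ge0 => x _; rewrite lee_fin sqr_ge0.
case: I I0 => [v| |] //; rewrite ?lee_fin // => v0.
rewrite powR12_sqrt // => ev vB; apply: le_trans vB.
by rewrite -(sqr_sqrtr v0) lerXn2r ?nnegrE // sqrtr_ge0.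
Qed.

(** Bounded densities cannot be far from the uniform one: this empties the
    alternative when there are few bins. *)
Lemma L2dist_bounded {d : nat} (f : 'rV[R]_d -> R) (L eps : R) : 0 <= L ->
  measurable_fun (@unit_cube R d) f ->
  (forall x, unit_cube x -> `|f x| <= L) -> 0 <= eps ->
  (eps%:E <= L2dist f (@uniform_density R d))%E -> eps <= L + 1.
Proof.
move=> L0 mf fL eps0 epsf.
rewrite -(@ler_pXn2r _ 2) ?nnegrE ?addr_ge0 //.
apply: (L2dist_le_sqr eps0 epsf).
have := @volume_unit_cube R d => v1.
rewrite -[leRHS]mule1 -v1 -integral_cst; last exact: measurable_unit_cube.
apply: ge0_le_integral => //.
- exact: measurable_unit_cube.
- by move=> x _; rewrite lee_fin sqr_ge0.
- apply/measurable_EFinP; apply: measurable_funX; apply: measurable_funB => //.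
  exact: measurable_cst.
- move=> x cx; have h : `|f x - uniform_density x| <= L + 1.
    by rewrite (le_trans (ler_normB _ _)) // lerD ?fL // normr1.
  rewrite lee_fin -[X in X <= _]real_normK ?num_real //.
  by rewrite lerXn2r ?nnegrE ?addr_ge0.
Qed.

End final_estimates.

Unset Implicit Arguments.

Theorem theorem2 (R : realType) (d : nat) (hd : (1 <= d)%N)
    (L : R) (hL : 0 < L) :
  exists c1 : R, 0 < c1 /\
  forall s : R, 0 < s ->
  exists c2 : R, 0 < c2 /\
  forall (m : nat) (a eps : R), (1 <= m)%N -> 1 <= a ->
    let kappa := Num.truncn (m%:R `^ (2 / (4 * s + d%:R)) : R) in
    let tau := m%:R + a * m%:R * kappa%:R `^ (- (d%:R / 2)) in
    c2 * a * m%:R `^ (- (2 * s / (4 * s + d%:R))) <= eps ->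
    (risk eps (@chi2_test R d m kappa tau) (holder s L)
      <= (c1 / a ^+ 2)%:E)%E.
Proof.
exists (4 + 5 * L); split; first by rewrite addr_gt0 // mulr_gt0.
move=> s s0.
have [A [C [A0 C0 gapP]]] := @L2_le_power_gap R d s L s0 (ltW hL) hd.
pose N := (strict_floor s).+1.*2.
pose NR : R := N%:R.
have NR1 : 1 <= NR by rewrite /NR ler1n double_gt0.
(* the first summand empties the alternative when kappa < N; the others make the
   signal dominate the approximation error C * kappa ^ (- 2 s) and the noise *)
pose c2 := (L + 2) * NR `^ s + (C * (2 `^ s) ^+ 2 + 32 * A) + 1.
have NRs : 0 < NR `^ s by rewrite powR_gt0 // (lt_le_trans _ NR1).
have P1 : 0 < (L + 2) * NR `^ s by rewrite mulr_gt0 // addr_gt0.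
have P2 : 0 <= C * (2 `^ s) ^+ 2 by rewrite mulr_ge0 ?sqr_ge0 // ltW.
have c20 : 1 <= c2 by rewrite /c2; lra.
exists c2; split; first by lra.
move=> m a eps m1 a1; set E := 4 * s + d%:R; move=> kappa tau epsP.
have a0 : 0 < a by lra.
have mR1 : 1 <= m%:R :> R by rewrite ler1n.
have mR0 : 0 < m%:R :> R by lra.
have dR : 1 <= d%:R :> R by rewrite ler1n.
have E0 : 0 < E by rewrite /E; lra.
pose x : R := m%:R `^ (2 / E).
pose r : R := m%:R `^ (- (2 * s / E)).
have r0 : 0 < r by rewrite powR_gt0.
have x0 : 0 < x by rewrite powR_gt0.
have x1 : 1 <= x.
  by rewrite -(powRr0 m%:R) ler_powR // divr_ge0 // ltW.
have /andP[kx xk] : (kappa%:R : R) <= x < kappa.+1%:R.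
  by apply: truncn_itv; exact: ltW.
have k0 : (0 < kappa)%N by rewrite truncn_gt0.
have kR1 : 1 <= kappa%:R :> R by rewrite ler1n.
have kR0 : 0 < kappa%:R :> R by rewrite ltr0n.
have rx : r = (x `^ s)^-1.
  by rewrite /r /x -powRrM powRN mulrAC.
pose S : R := kappa%:R `^ (d%:R / 2).
have S0 : 0 < S by rewrite powR_gt0.
have S1 : 1 <= S.
  by rewrite -(powRr0 kappa%:R) ler_powR // divr_ge0.
have SK : S ^+ 2 = kappa%:R ^+ d.
  rewrite -[LHS]powR_mulrn ?(ltW S0) // /S -powRrM -powR_mulrn ?(ltW kR0) //.
  by congr (_ `^ _); field.
have tauE : tau = m%:R + a * m%:R / S by rewrite /tau powRN.
(* S / m is the order of the smallest detectable squared distance; the choice of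
   kappa makes it at most the square of the rate r *)
have Sr : S <= m%:R * r ^+ 2.
  apply: (@le_trans _ _ (x `^ (d%:R / 2))).
    by rewrite ge0_ler_powR ?nnegrE ?divr_ge0 // ltW.
  rewrite /x /r -[X in _ <= _ * X]powR_mulrn ?powR_ge0 // -!powRrM.
  rewrite -{2}[m%:R]powRr1 ?(ltW mR0) // -powRD; last first.
    by apply/implyP => _; rewrite gt_eqF.
  rewrite le_eqVlt; apply/orP; left; apply/eqP; congr (_ `^ _).
  by rewrite /E; field; rewrite gt_eqF.
have eps0 : 0 < eps.
  by apply: lt_le_trans epsP; rewrite mulr_gt0 // mulr_gt0 //; lra.
have typeI : (expect (@uniform_density R d) (@chi2_test R d m kappa tau)
    <= (4 / a ^+ 2)%:E)%E.
  pose p0 := @bin_prob R d kappa (@uniform_density R d).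
  have gap0 : power_gap p0 = 0.
    rewrite /power_gap big1 // => k _; rewrite /p0 bin_prob_uniform //.
    by rewrite card_tuple card_ord natrX subrr expr0n.
  pose t := a * m%:R / S.
  have t0 : 0 < t by rewrite divr_gt0 // mulr_gt0.
  have [+ _] := @chi2_test_errors R d kappa m k0 (@uniform_density R d) 1 tau t
    (uniform_is_density) ler01 (fun _ _ => lexx 1) t0.
  rewrite -/p0 gap0 => typeI; apply: le_trans (typeI _) _.
    rewrite /cell_chi2_mean gap0 mulr0 addr0 tauE -/t lerD2r.
    by rewrite gerBl divr_ge0.
  rewrite lee_fin mulr0 add0r -SK /t le_eqVlt; apply/orP; left; apply/eqP.
  by field; rewrite !gt_eqF.
have typeII f : holder s L f -> is_density f ->
    (eps%:E <= L2dist f (@uniform_density R d))%E ->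
    (expect f (fun X => 1 - @chi2_test R d m kappa tau X)%R
      <= (5 * L / a ^+ 2)%:E)%E.
  move=> Hf fd epsf.
  have fL y : unit_cube y -> `|f y| <= L by exact: holder_bounded Hf.
  have NK : (N <= kappa)%N.
    rewrite leqNgt; apply/negP => kN.
    have mf : measurable_fun (@unit_cube R d) f by case: fd.
    have := L2dist_bounded (ltW hL) mf fL (ltW eps0) epsf.
    apply/negP; rewrite -ltNge; apply: lt_le_trans epsP.
    have xN : x `^ s <= NR `^ s.
      apply: ge0_ler_powR; rewrite ?nnegrE ?(ltW s0) ?(ltW x0) //.
      by rewrite (le_trans (ltW xk)) // ler_nat.
    rewrite -/r rx ltr_pdivlMr ?powR_gt0 //.
    have h1 : (L + 1) * x `^ s <= (L + 1) * NR `^ s.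
      by rewrite ler_wpM2l // addr_ge0 // ltW.
    have h2 : c2 <= c2 * a by rewrite ler_peMr // (le_trans ler01).
    by apply: (le_lt_trans h1); apply: (lt_le_trans _ h2); rewrite /c2; lra.
  have m2 : 2 <= m%:R :> R.
    rewrite ler_nat ltn_neqAle m1 andbT; apply/eqP => m1'.
    have : (2 <= kappa)%N by apply: leq_trans NK; rewrite /N doubleS.
    rewrite -(ler_nat R) => /le_trans /(_ kx).
    by rewrite /x -m1' powR1; lra.
  pose p := @bin_prob R d kappa f.
  set q := kappa%:R^-1 `^ s; pose gap := power_gap p.
  have gap_ge0 : 0 <= gap by apply: sumr_ge0 => k _; exact: sqr_ge0.
  have epsB := L2dist_le_sqr (ltW eps0) epsf (gapP f kappa NK fd Hf).
  have qr : q <= 2 `^ s * r.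
    rewrite rx -[(x `^ s)^-1]powRN -[- s]mulN1r powRrM powR_inv1 ?(ltW x0) //.
    rewrite -powRM ?invr_ge0 ?(ltW x0) //.
    apply: ge0_ler_powR; rewrite ?nnegrE ?invr_ge0 ?mulr_ge0 ?invr_ge0 ?(ltW s0) ?(ltW x0) //.
    rewrite -[_ * _]invrK lef_pV2 ?posrE ?invr_gt0 ?mulr_gt0 ?invr_gt0 //.
    rewrite invfM invrK mulrC ler_pdivrMr // (le_trans (ltW xk)) //.
    by rewrite -natr1; lra.
  have q0 : 0 <= q by exact: powR_ge0.
  have q2 : C * q ^+ 2 <= C * (2 `^ s) ^+ 2 * r ^+ 2.
    rewrite -mulrA ler_wpM2l ?(ltW C0) // -exprMn lerXn2r ?nnegrE //.
    by rewrite mulr_ge0 ?powR_ge0 // ltW.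
  have eps2 : c2 ^+ 2 * a ^+ 2 * r ^+ 2 <= eps ^+ 2.
    rewrite -!exprMn lerXn2r ?nnegrE ?(ltW eps0) // mulr_ge0 ?(ltW r0) // mulr_ge0 ?(ltW a0) //; lra.
  have a21 : 1 <= a ^+ 2 by rewrite exprn_ege1.
  have c2sq : C * (2 `^ s) ^+ 2 + 32 * A <= c2 ^+ 2.
    apply: (@le_trans _ _ c2); first by rewrite /c2; lra.
    by rewrite expr2 ler_peMr // (le_trans ler01).
  have Kgap : 32 * a ^+ 2 * r ^+ 2 <= kappa%:R ^+ d * gap.
    rewrite -(ler_pM2l A0).
    have r20 : 0 <= r ^+ 2 by exact: sqr_ge0.
    have h1 : (C * (2 `^ s) ^+ 2 + 32 * A) * a ^+ 2 <= c2 ^+ 2 * a ^+ 2.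
      by rewrite ler_wpM2r ?sqr_ge0.
    have h2 : C * (2 `^ s) ^+ 2 <= C * (2 `^ s) ^+ 2 * a ^+ 2 by rewrite ler_peMr.
    have h3 : (C * (2 `^ s) ^+ 2 + 32 * A * a ^+ 2) * r ^+ 2 <=
        c2 ^+ 2 * a ^+ 2 * r ^+ 2 by rewrite ler_wpM2r //; lra.
    move: epsB q2 eps2; rewrite -/p -/gap -/q; lra.
  have margin : 32 * a ^+ 2 * m%:R / S <= m%:R ^+ 2 * gap.
    rewrite ler_pdivrMr //.
    have h1 : 32 * a ^+ 2 * S <= m%:R * (kappa%:R ^+ d * gap).
      apply: (@le_trans _ _ (m%:R * (32 * a ^+ 2 * r ^+ 2))).
        have -> : m%:R * (32 * a ^+ 2 * r ^+ 2) = 32 * a ^+ 2 * (m%:R * r ^+ 2) by ring.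
        by rewrite ler_wpM2l // mulr_ge0 ?sqr_ge0.
      by rewrite ler_wpM2l // ltW.
    rewrite -SK in h1.
    have h2 : 32 * a ^+ 2 <= m%:R * (S * gap).
      rewrite -(ler_pM2r S0); apply: (le_trans h1).
      by rewrite le_eqVlt; apply/orP; left; apply/eqP; ring.
    have := ler_wpM2l (ltW mR0) h2.
    lra.
  pose t := m%:R ^+ 2 * gap / 4.
  have t0 : 0 < t.
    rewrite divr_gt0 // (lt_le_trans _ margin) // divr_gt0 // mulr_gt0 //.
    by rewrite mulr_gt0 // exprn_gt0.
  have fL' y : unit_cube y -> f y <= L by move=> /fL; exact: le_trans (ler_norm _).
  have [_ typeII] := @chi2_test_errors R d kappa m k0 f L tau t fd (ltW hL) fL' t0.
  apply: le_trans (typeII _) _.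
    rewrite /cell_chi2_mean card_tuple card_ord natrX -SK tauE.
    exact: type_two_margin m2 S1 a1 margin.
  rewrite lee_fin -SK; exact: type_two_bound m2 S1 a1 (ltW hL) margin.
rewrite /risk (mulrDl 4 (5 * L)) EFinD; apply: leeD; first exact: typeI.
apply: sup0_le; first by rewrite lee_fin divr_ge0 ?sqr_ge0 // mulr_ge0 // ltW.
by move=> _ [f [Hf fd epsf] <-]; exact: typeII.
Qed.
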